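(* Let $\mathfrak{X}$ be an abstract state space and let $(\mathcal{U}(t))_{t\ge 0}$ be a substochastic $C_0$-semigroup on $\mathfrak{X}$ with generator $\mathcal{A}$ with domain $\mathscr{D}(\mathcal{A})$. Let $\mathcal{B}:\mathscr{D}(\mathcal{A})\to\mathfrak{X}$ be a positive linear operator satisfying $$\langle \mathbf{\Psi},(\mathcal{A}+\mathcal{B})u\rangle\le 0\qquad\text{for all } u\in\mathscr{D}(\mathcal{A})_+:=\mathscr{D}(\mathcal{A})\cap\mathfrak{X}_+ .$$ Then there exists an extension $\mathcal{G}$ of $(\mathcal{A}+\mathcal{B},\mathscr{D}(\mathcal{A}))$ that generates a substochastic $C_0$-semigroup $(\mathcal{V}(t))_{t\ge0}$ on $\mathfrak{X}$. Moreover, for every $\lambda>0$ the resolvent of $\mathcal{G}$ is given by $$(\lambda-\mathcal{G})^{-1}u=\lim_{n\to\infty}(\lambda-\mathcal{A})^{-1}\sum_{k=0}^n\left[\mathcal{B}(\lambda-\mathcal{A})^{-1}\right]^k u,\qquad u\in\mathfrak{X}.$$ Finally, $(\mathcal{V}(t))_{t\ge0}$ is the smallest substochastic $C_0$-semigroup whose generator is an extension of $(\mathcal{A}+\mathcal{B},\mathscr{D}(\mathcal{A}))$; that is, if $(\mathcal{S}(t))_{t\ge0}$ is a substochastic $C_0$-semigroup on $\mathfrak{X}$ whose generator extends $(\mathcal{A}+\mathcal{B},\mathscr{D}(\mathcal{A}))$, then $\mathcal{V}(t)\le\mathcal{S}(t)$ for all $t\ge0$.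
   Context: An abstract state space is a real ordered Banach space $\mathfrak{X}$ whose positive cone $\mathfrak{X}_+$ (closed, convex, proper) is generating, $\mathfrak{X}=\mathfrak{X}_+-\mathfrak{X}_+$, and on which the norm is additive: $\|u+v\|=\|u\|+\|v\|$ for $u,v\in\mathfrak{X}_+$. No lattice structure is assumed. $\mathbf{\Psi}\in\mathfrak{X}^\star_+$ is the positive continuous linear functional with $\langle\mathbf{\Psi},u\rangle=\|u\|$ for all $u\in\mathfrak{X}_+$. A linear operator is positive if it maps the positive elements of its domain into $\mathfrak{X}_+$; for bounded operators $S\le T$ means that $T-S$ is positive. A $C_0$-semigroup $(T(t))_{t\ge0}$ on $\mathfrak{X}$ is substochastic if each $T(t)$ is positive and $\|T(t)u\|\le\|u\|$ for all $u\in\mathfrak{X}_+$, $t\ge0$. *)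

(* Defs.v *)
From HB Require Import structures.
From mathcomp Require Import all_boot all_order all_algebra.
From mathcomp Require Import all_classical all_reals all_analysis.

Set Implicit Arguments.
Unset Strict Implicit.
Unset Printing Implicit Defensive.

Import Order.TTheory GRing.Theory Num.Theory.
Import numFieldNormedType.Exports.

Local Open Scope classical_set_scope.
Local Open Scope ring_scope.

(* The order of the state space is carried by the positive cone [C]:
   [u <= v] means [C (v - u)]. *)
Record abstract_state_space (R : realType) (X : completeNormedModType R)
    (C : set X) : Prop := AbstractStateSpace {
  cone_closed : closed C;
  cone_add : forall u v, C u -> C v -> C (u + v);
  cone_scale : forall (a : R) u, 0 <= a -> C u -> C (a *: u);
  cone_proper : forall u, C u -> C (- u) -> u = 0;
  cone_generating : forall x, exists u v, [/\ C u, C v & x = u - v];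
  norm_additive : forall u v, C u -> C v -> `|u + v| = `|u| + `|v|
}.

(* The hypotheses determine [Psi] uniquely because the cone is generating;
   positivity of [Psi] is contained in the second one. *)
Definition norm_functional (R : realType) (X : completeNormedModType R)
    (C : set X) (Psi : {scalar X}) : Prop :=
  continuous (Psi : X -> R) /\ forall u, C u -> Psi u = `|u|.

(* A linear operator defined on a linear subspace [dom]; the values of [op_fun]
   outside [dom] are irrelevant. *)
Record operator (R : realType) (X : completeNormedModType R) := Operator {
  dom : set X;
  op_fun :> X -> X;
  dom_zero : dom 0;
  dom_linear : forall (a : R) u v, dom u -> dom v -> dom (a *: u + v);
  op_linear : forall (a : R) u v, dom u -> dom v ->
    op_fun (a *: u + v) = a *: op_fun u + op_fun v
}.

Section Operators.
Context {R : realType} {X : completeNormedModType R}.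
Implicit Types (A B : operator X) (T : R -> X -> X) (C : set X).

Lemma add_op_dom_linear A B (a : R) u v :
  (dom A `&` dom B) u -> (dom A `&` dom B) v ->
  (dom A `&` dom B) (a *: u + v).
Proof. by move=> [? ?] [? ?]; split; exact: dom_linear. Qed.

Lemma add_op_linear A B (a : R) u v :
  (dom A `&` dom B) u -> (dom A `&` dom B) v ->
  A (a *: u + v) + B (a *: u + v) = a *: (A u + B u) + (A v + B v).
Proof.
by move=> [Au Bu] [Av Bv]; rewrite !op_linear// scalerDr addrACA.
Qed.

Definition add_op A B : operator X :=
  @Operator R X (dom A `&` dom B) (fun u => A u + B u)
    (conj (dom_zero A) (dom_zero B)) (@add_op_dom_linear A B)
    (@add_op_linear A B).

Definition extends B A : Prop :=
  dom A `<=` dom B /\ forall u, dom A u -> B u = A u.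

Definition positive_op C A : Prop := forall u, dom A u -> C u -> C (A u).

(* [(lambda - A)^-1 x]: the solution [y] in [dom A] of [lambda y - A y = x]
   (and 0 if there is none). *)
Definition resolvent A (lambda : R) (x : X) : X :=
  xget 0 [set y | dom A y /\ lambda *: y - A y = x].

Definition in_resolvent_set A (lambda : R) : Prop :=
  set_bij (dom A) setT (fun u => lambda *: u - A u) /\
  continuous (resolvent A lambda).

(* Only the values [T t] for [0 <= t] are constrained. *)
Record C0_semigroup T : Prop := C0Semigroup {
  semigroup_linear : forall t, 0 <= t -> linear (T t);
  semigroup_bounded : forall t, 0 <= t -> continuous (T t);
  semigroup0 : forall u, T 0 u = u;
  semigroupD : forall s t u, 0 <= s -> 0 <= t -> T (s + t) u = T s (T t u);
  semigroup_cvg0 : forall u, T t u @[t --> 0^'+] --> u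
}.

Definition generates A T : Prop :=
  dom A = [set u | cvg (h^-1 *: (T h u - u) @[h --> 0^'+])] /\
  forall u, dom A u -> h^-1 *: (T h u - u) @[h --> 0^'+] --> A u.

Record substochastic C T : Prop := Substochastic {
  substochastic_C0 : C0_semigroup T;
  substochastic_pos : forall t u, 0 <= t -> C u -> C (T t u);
  substochastic_contr : forall t u, 0 <= t -> C u -> `|T t u| <= `|u|
}.

Definition bounded_op_le C (S T : X -> X) : Prop :=
  forall u, C u -> C (T u - S u).

End Operators.

(* Main.v *)
Require Import Defs.
From HB Require Import structures.
From mathcomp Require Import all_boot all_order all_algebra.
From mathcomp Require Import all_classical all_reals all_analysis.
From mathcomp Require Import ring lra.

Import Order.TTheory GRing.Theory Num.Theory.
Import numFieldNormedType.Exports.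

Local Open Scope classical_set_scope.
Local Open Scope ring_scope.

Set Implicit Arguments.
Unset Strict Implicit.
Unset Printing Implicit Defensive.

(* The unbounded operators are handled through the implicit Euler steps
   [J h = (1 - h G)^-1], i.e. [lam (lam - G)^-1] at [lam = 1 / h]: for a
   substochastic semigroup they are positive and contract the norm on the cone,
   a property stable under composition, convex combination and strong limits.
   By Baire's theorem such maps are bounded on all of [X] by one constant.
   - For the generator of a given semigroup, [J h] is the Laplace transform of
     the semigroup, obtained as a limit of Abel means [(1 - q) (1 - q T(s))^-1]
     with [q = exp (- lam s)] and dyadic [s -> 0].
   - Conversely a family [J] with dense range yields the semigroup
     [V(t) = lim (J h) ^ floor (t / h)] along dyadic [h -> 0], and this formula
     recovers any substochastic semigroup from its generator.
   - For [A + B], dissipativity gives [|J h u| + |h B J h u| <= |u|] on the cone,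
     so the Neumann sums increase with bounded norm and converge, the norm being
     additive on the cone. The delicate point is the resolvent identity for the
     limits, which says that the remainders [(h B J h) ^ n u] vanish in the limit.
   - If the generator of [S] extends [A + B], its resolvent dominates every
     Neumann sum; the exponential formula turns this into [V(t) <= S(t)]. *)

(* [R * X] with [X * X = 0] is a commutative ring containing [X]: this lets [ring]
   decide the identities of the module [X]. *)
Definition square_zero_ext (R : comNzRingType) (X : lmodType R) : Type := (R * X)%type.

Section SquareZero.
Context {R : comNzRingType} {X : lmodType R}.
Local Notation E := (square_zero_ext X).
Implicit Types (p q r : E).

HB.instance Definition _ := GRing.Zmodule.copy E (R * X)%type.

Definition sqz_mul p q : E := (p.1 * q.1, p.1 *: q.2 + q.1 *: p.2).
Definition sqz_one : E := (1, 0).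

Lemma sqz_mulA : associative sqz_mul.
Proof.
move=> [a x] [b y] [c z]; congr pair; rewrite /= ?mulrA//.
by rewrite !scalerDr !scalerA addrA (mulrC c a) (mulrC c b).
Qed.

Lemma sqz_mulC : commutative sqz_mul.
Proof. by move=> [a x] [b y]; congr pair; rewrite /= 1?mulrC// addrC. Qed.

Lemma sqz_mul1 : left_id sqz_one sqz_mul.
Proof. by move=> [a x]; congr pair; rewrite /= ?mul1r// scale1r scaler0 addr0. Qed.

Lemma sqz_mulDl : left_distributive sqz_mul +%R.
Proof.
move=> [a x] [b y] [c z]; congr pair; rewrite /= ?mulrDl//.
by rewrite scalerDl scalerDr addrACA.
Qed.

Lemma sqz_one_neq0 : sqz_one != 0.
Proof. by apply/eqP => -[/eqP]; rewrite oner_eq0. Qed.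

HB.instance Definition _ := GRing.Zmodule_isComNzRing.Build E
  sqz_mulA sqz_mulC sqz_mul1 sqz_mulDl sqz_one_neq0.

Definition sqz_scalar (a : R) : E := (a, 0).
Definition sqz_vector (x : X) : E := (0, x).

Lemma sqz_scalar_zmod : zmod_morphism sqz_scalar.
Proof. by move=> a b; congr pair; rewrite /= subr0. Qed.
Lemma sqz_scalar_monoid : monoid_morphism sqz_scalar.
Proof. by split=> // a b; congr pair; rewrite /= !scaler0 addr0. Qed.
HB.instance Definition _ := GRing.isZmodMorphism.Build R E sqz_scalar sqz_scalar_zmod.
HB.instance Definition _ := GRing.isMonoidMorphism.Build R E sqz_scalar sqz_scalar_monoid.
Lemma sqz_vector_zmod : zmod_morphism sqz_vector.
Proof. by move=> a b; congr pair; rewrite /= subr0. Qed.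
HB.instance Definition _ := GRing.isZmodMorphism.Build X E sqz_vector sqz_vector_zmod.

Lemma sqz_vector0 : sqz_vector 0 = 0.
Proof. by []. Qed.

Lemma sqz_vectorD x y : sqz_vector (x + y) = sqz_vector x + sqz_vector y.
Proof. exact: raddfD. Qed.

Lemma sqz_vectorN x : sqz_vector (- x) = - sqz_vector x.
Proof. exact: raddfN. Qed.

Lemma sqz_vectorZ a x : sqz_vector (a *: x) = sqz_scalar a * sqz_vector x.
Proof. by congr pair; rewrite /= ?mulr0// scale0r addr0. Qed.

Lemma sqz_vector_inj : injective sqz_vector.
Proof. by move=> x y []. Qed.
End SquareZero.


Ltac lmodule := apply: sqz_vector_inj;
  rewrite ?(sqz_vectorD, sqz_vectorN, sqz_vectorZ, sqz_vector0); ring.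

(** * Limits of sequences in a Banach space *)

Section SequenceLimits.
Context {R : realType} {X : completeNormedModType R}.
Implicit Types (u v : nat -> X) (x y : X).

Lemma norm_scale_ge0 (a : R) x : 0 <= a -> `|a *: x| = a * `|x|.
Proof. by move=> a0; rewrite normrZ ger0_norm. Qed.

Lemma cvgn_dist_le u x : u n @[n --> \oo] --> x <->
  forall e : R, 0 < e -> exists N, forall n, (N <= n)%N -> `|u n - x| <= e.
Proof.
split=> [/cvgrPdist_le h e /h[N _ hN]|h].
  by exists N => n Nn; rewrite distrC; exact: hN.
apply/cvgrPdist_le => e /h[N hN]; exists N => // n Nn.
by rewrite /= distrC hN.
Qed.

Lemma cvgn_unique u x y :
  u n @[n --> \oo] --> x -> u n @[n --> \oo] --> y -> x = y.
Proof. by move=> ux uy; exact: (cvg_unique _ ux uy). Qed.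

Lemma cauchy_tail_cvgn u :
  (forall e : R, 0 < e -> exists N, forall n, (N <= n)%N -> `|u n - u N| <= e) ->
  cvgn u.
Proof.
move=> h; apply/cauchy_cvgP/cauchy_exP => e e0.
have [|N hN] := h (e / 2); first by rewrite divr_gt0.
exists (u N); exists N => // n Nn; rewrite /= -ball_normE /= distrC.
by rewrite (le_lt_trans (hN n Nn))// ltr_pdivrMr// ltr_pMr// ltr1n.
Qed.
End SequenceLimits.

(** * Geometry of the cone: monotone convergence and bounded decomposition *)

Section Cone.
Context {R : realType} {X : completeNormedModType R} {C : set X}
  (hX : abstract_state_space C).
Implicit Types (u v x y : X).

Let cD := cone_add hX.
Let cZ := cone_scale hX.

Lemma cone0 : C 0.
Proof.
have [u [_ [Cu _ _]]] := cone_generating hX 0.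
by rewrite -(scale0r u); exact: cZ.
Qed.

Lemma cone_trans x y z : C (y - x) -> C (z - y) -> C (z - x).
Proof. by move=> xy yz; rewrite -(subrK y z) -addrA; exact: cD. Qed.

Lemma norm_cone_sub x y : C x -> C (y - x) -> `|y - x| = `|y| - `|x|.
Proof.
move=> Cx /(norm_additive hX Cx); rewrite (addrC x) subrK => ->.
by rewrite addrAC subrr add0r.
Qed.

Lemma norm_cone_mono x y : C x -> C (y - x) -> `|x| <= `|y|.
Proof. by move=> Cx Cyx; rewrite -subr_ge0 -norm_cone_sub. Qed.

Lemma cone_incr_le {w : nat -> X} : (forall n, C (w n.+1 - w n)) ->
  forall m n, (m <= n)%N -> C (w n - w m).
Proof.
move=> wS m n /subnK <-; elim: (n - m)%N => [|k ih]; first by rewrite subrr; exact: cone0.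
by rewrite addSn; exact: cone_trans ih (wS _).
Qed.

(** The norm being additive on the cone, [|w n - w m| = |w n| - |w m|] for [m <= n]: convergence of
    the increasing bounded norms makes [w] a Cauchy sequence. *)
Lemma cone_incr_cvgn (w : nat -> X) (b : R) : C (w 0%N) ->
  (forall n, C (w n.+1 - w n)) -> (forall n, `|w n| <= b) -> cvgn w.
Proof.
move=> w0 wS wb.
have wle := cone_incr_le wS.
have Cw n : C (w n).
  by rewrite -(subrK (w 0%N) (w n)); apply: cD => //; exact: wle.
have nd : nondecreasing_seq (fun n => `|w n|).
  by move=> m n mn; apply: norm_cone_mono => //; exact: wle.
have cw : cvgn (fun n => `|w n|).
  apply: nondecreasing_is_cvgn => //. by exists b => _ [n _ <-]; exact: wb.
apply: cauchy_tail_cvgn => e e0.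
have /cvgrPdist_le/(_ e e0)[N _ hN] := cw.
exists N => n Nn; rewrite norm_cone_sub//; last exact: wle.
rewrite lerBlDr (le_trans (nondecreasing_cvgn_le nd cw n))// -lerBlDr.
by rewrite (le_trans (ler_norm _))//; apply: hN => /=.
Qed.

Lemma cone_limn (w : nat -> X) x : (forall n, C (w n)) ->
  w n @[n --> \oo] --> x -> C x.
Proof.
by move=> Cw; apply: closed_cvg; [exact: cone_closed|near=> n; exact: Cw].
Unshelve. all: by end_near.
Qed.

Let bounded_part (n : nat) : set X :=
  [set x | exists u v, [/\ C u, C v, x = u - v & `|u| + `|v| <= n%:R]].

(** Baire's theorem: the sets [bounded_part n] cover [X] because the cone is generating, so the
    closure of one of them has an interior point. *)
Lemma ball_sub_closure_bounded_part :
  exists n x (r : R), 0 < r /\ ball x r `<=` closure (bounded_part n).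
Proof.
set O := fun n => ~` closure (bounded_part n).
have Oopen n : open (O n) by apply: closed_openC; exact: closed_closure.
have [n nd] : exists n, ~ dense (O n).
  apply: contrapT => /forallNP nd.
  have /Baire dO : forall n, open (O n) /\ dense (O n).
    by move=> n; split => //; apply: contrapT; exact: nd.
  have /(_ setT) := dO; case=> [|| x [_ Ox]].
  - by exists 0.
  - exact: openT.
  have [u [v [Cu Cv xE]]] := cone_generating hX x.
  apply: (Ox (Num.truncn (`|u| + `|v|)).+1 I); apply: subset_closure.
  exists u, v; split => //; apply: ltW.
  by rewrite -truncn_le_nat// ltnS.
have [D [ [x xD] Dn]] := denseNE nd.
have [r r0 xr] : exists2 r : R, 0 < r & ball x r `<=` D.
  by have /nbhs_ballP[r r0 xr] := open_nbhs_nbhs xD; exists r.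
exists n, x, r; split => // y /xr Dy; apply: contrapT => yn.
by have : (D `&` O n) y by []; rewrite Dn.
Qed.

(** Any [x] is a multiple of the difference of two points symmetric about the centre [x0] of the
    ball given by Baire's theorem. Both are approximated in [bounded_part n], and the negative part
    of the one joins the positive part of the other. *)
Lemma cone_approx : exists2 c : R, 0 <= c & forall x (e : R), 0 < e ->
  exists u v, [/\ C u, C v, `|u| + `|v| <= c * `|x| & `|x - (u - v)| <= e].
Proof.
have [n [x0 [r [r0 br]]]] := ball_sub_closure_bounded_part.
exists (2 * n%:R / r) => [|x e e0]; first by rewrite divr_ge0 ?mulr_ge0// ltW.
have [->|x_neq0] := eqVneq x 0.
  exists 0, 0; rewrite !subr0 normr0 mulr0 addr0.
  by split => //; [exact: cone0|exact: cone0|exact: ltW].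
have nx0 : 0 < `|x| by rewrite normr_gt0.
(* With this [s], the points [x0 + s^-1 *: x] and [x0 - s^-1 *: x] lie at distance [r / 2] from
   [x0]. *)
pose s := 2 * `|x| / r.
have s0 : 0 < s by rewrite divr_gt0 ?mulr_gt0.
have approx y : `|y - x0| < r -> exists u v,
    [/\ C u, C v, `|u| + `|v| <= n%:R & `|y - (u - v)| <= e / s].
  move=> yr.
  have /br/(_ (ball y (e / s)))[] : ball x0 r y by rewrite -ball_normE /= distrC.
    by apply: nbhsx_ballx; rewrite divr_gt0.
  move=> _ [ [u [v [Cu Cv -> uvn]]]]; rewrite -ball_normE /= => yuv.
  by exists u, v; split => //; exact: ltW.
have yr : `|s^-1 *: x| < r.
  rewrite normrZ gtr0_norm ?invr_gt0// /s.
  have -> : (2 * `|x| / r)^-1 * `|x| = r / 2 by field; lra.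
  lra.
have [|u1 [v1 [Cu1 Cv1 n1 a1]]] := approx (x0 + s^-1 *: x).
  by rewrite addrC addKr.
have [|u2 [v2 [Cu2 Cv2 n2 a2]]] := approx (x0 - s^-1 *: x).
  by rewrite addrC addKr normrN.
have s2 : 0 <= s / 2 by rewrite divr_ge0 ?ltW.
exists ((s / 2) *: (u1 + v2)), ((s / 2) *: (u2 + v1)); split.
- by apply: cZ => //; exact: cD.
- by apply: cZ => //; exact: cD.
- rewrite !(norm_scale_ge0 _ s2) -mulrDr.
  have -> : 2 * n%:R / r * `|x| = s / 2 * (n%:R + n%:R) by rewrite /s; field; lra.
  apply: ler_wpM2l => //.
  have := ler_normD u1 v2; have := ler_normD u2 v1; lra.
- have -> : x - ((s / 2) *: (u1 + v2) - (s / 2) *: (u2 + v1)) =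
      (s / 2) *: ((x0 + s^-1 *: x - (u1 - v1)) - (x0 - s^-1 *: x - (u2 - v2))).
    have x1 : (s / 2 * s^-1 * 2) *: x = x.
      by rewrite [X in X *: _](_ : _ = 1) ?scale1r//; field; lra.
    by rewrite -[X in X - _]x1; lmodule.
  rewrite (norm_scale_ge0 _ s2).
  have -> : e = s / 2 * (e / s + e / s) by field; lra.
  apply: ler_wpM2l => //.
  by rewrite (le_trans (ler_normB _ _))// lerD.
Qed.

(** Successive approximation as in the open mapping theorem: the error left by [cone_approx] is
    halved at each stage, so the positive and the negative parts add up to increasing sequences
    whose norms are bounded by a geometric series. *)
Lemma cone_decomposition : exists2 M : R, 0 < M & forall x,
  exists u v, [/\ C u, C v, x = u - v & `|u| + `|v| <= M * `|x|].
Proof.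
have [c c0 approx] := cone_approx.
have /choice[f fP] : forall x, exists p : X * X,
    [/\ C p.1, C p.2, `|p.1| + `|p.2| <= c * `|x| & `|x - (p.1 - p.2)| <= `|x| / 2].
  move=> x; have [->|x0] := eqVneq x 0.
    exists (0, 0); rewrite /= !subr0 normr0 mulr0 addr0 mul0r.
    by split=> //; exact: cone0.
  have [|u [v [Cu Cv uv xuv]]] := approx x (`|x| / 2).
    by rewrite divr_gt0 ?normr_gt0.
  by exists (u, v).
(* [2 * c] is the sum of the series [c / 2 ^ k]; the added 1 makes the constant positive even if
   [c = 0]. *)
exists (2 * c + 1) => [|x]; first lra.
pose r n := iter n (fun y => y - ((f y).1 - (f y).2)) x.
pose u n := \sum_(0 <= k < n) (f (r k)).1.
pose v n := \sum_(0 <= k < n) (f (r k)).2.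
have uS n : u n.+1 = u n + (f (r n)).1 by rewrite /u big_nat_recr.
have vS n : v n.+1 = v n + (f (r n)).2 by rewrite /v big_nat_recr.
have rn n : `|r n| <= `|x| / 2 ^+ n.
  elim: n => [|n ih]; first by rewrite expr0 divr1.
  have [_ _ _] := fP (r n); rewrite -/(r n.+1) => /le_trans; apply.
  by rewrite exprSr invfM mulrA ler_pM2r// invr_gt0.
have xE n : x = u n - v n + r n.
  elim: n => [|n ih]; first by rewrite /u /v !big_geq// subrr add0r.
  rewrite [LHS]ih uS vS /= -/(r n); lmodule.
have uvn n : `|u n| + `|v n| <= 2 * c * `|x| * (1 - (2 ^+ n)^-1).
  elim: n => [|n ih].
    by rewrite /u /v !big_geq// normr0 expr0 invr1 subrr mulr0 addr0.
  rewrite uS vS; have [_ _ h _] := fP (r n).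
  have := ler_normD (u n) (f (r n)).1; have := ler_normD (v n) (f (r n)).2.
  have : c * `|r n| <= c * (`|x| / 2 ^+ n) by rewrite ler_wpM2l.
  rewrite exprSr invfM mulrA; move: (2 ^+ n)^-1 ih h => a ih h; lra.
have le1 n : 2 * c * `|x| * (1 - (2 ^+ n)^-1) <= 2 * c * `|x|.
  have /ler_piMr : 0 <= 2 * c * `|x| by rewrite !mulr_ge0.
  by apply; rewrite lerBlDr lerDl invr_ge0 exprn_ge0.
have u_cvg : cvgn u.
  apply: (@cone_incr_cvgn _ (2 * c * `|x|)) => [|n|n].
  - by rewrite /u big_geq//; exact: cone0.
  - by rewrite uS addrC addKr; case: (fP (r n)).
  - by rewrite (le_trans _ (le1 n))// (le_trans _ (uvn n))// lerDl.
have v_cvg : cvgn v.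
  apply: (@cone_incr_cvgn _ (2 * c * `|x|)) => [|n|n].
  - by rewrite /v big_geq//; exact: cone0.
  - by rewrite vS addrC addKr; case: (fP (r n)).
  - by rewrite (le_trans _ (le1 n))// (le_trans _ (uvn n))// lerDr.
exists (limn u), (limn v); split.
- apply: cone_limn u_cvg => n; rewrite /u; apply: big_ind => //; first exact: cone0.
  by move=> k _; case: (fP (r k)).
- apply: cone_limn v_cvg => n; rewrite /v; apply: big_ind => //; first exact: cone0.
  by move=> k _; case: (fP (r k)).
- have r0 : r n @[n --> \oo] --> 0.
    apply/norm_cvg0P; apply: (@squeeze_cvgr _ _ _ _ (fun=> 0) (geometric `|x| 2^-1)).
    + by near=> n; rewrite normr_ge0 /= exprVn rn.
    + exact: cvg_cst.
    + by apply: cvg_geometric; rewrite gtr0_norm// invf_lt1// ltr1n.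
  have xc : (u n - v n + r n) @[n --> \oo] --> limn u - limn v + 0.
    by apply: cvgD => //; exact: cvgB.
  rewrite addr0 (_ : (fun n => u n - v n + r n) = (fun=> x)) in xc; last first.
    by apply/funext => n; rewrite -xE.
  exact: (cvg_unique _ (cvg_cst x) xc).
- have nuv : (`|u n| + `|v n|) @[n --> \oo] --> `|limn u| + `|limn v|.
    exact: (cvgD (cvg_norm u_cvg) (cvg_norm v_cvg)).
  apply: (cvgr_to_le nuv).
  near=> n; rewrite (le_trans (uvn n))// (le_trans (le1 n))//.
  by rewrite ler_wpM2r// lerDl.
Unshelve. all: by end_near.
Qed.
End Cone.

(** * Elementary rules for linear maps *)

Section LinearMaps.
Context {R : pzRingType} {X : lmodType R} {f : X -> X} (lf : linear f).

Lemma linear_map0 : f 0 = 0.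
Proof. by have := lf (-1) 0 0; rewrite scaleN1r oppr0 addr0 scaleN1r addNr. Qed.

Lemma linear_mapD x y : f (x + y) = f x + f y.
Proof. by have := lf 1 x y; rewrite !scale1r. Qed.

Lemma linear_mapZ a x : f (a *: x) = a *: f x.
Proof. by have := lf a x 0; rewrite !addr0 linear_map0 addr0. Qed.

Lemma linear_mapN x : f (- x) = - f x.
Proof. by rewrite -scaleN1r linear_mapZ scaleN1r. Qed.

Lemma linear_mapB x y : f (x - y) = f x - f y.
Proof. by rewrite linear_mapD linear_mapN. Qed.

Lemma linear_map_sum (I : Type) (r : seq I) (P : pred I) (F : I -> X) :
  f (\sum_(i <- r | P i) F i) = \sum_(i <- r | P i) f (F i).
Proof. exact: (big_morph f linear_mapD linear_map0). Qed.

End LinearMaps.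

(** * Cone contractions: uniform bound and strong limits *)

Section ConeContractions.
Context {R : realType} {X : completeNormedModType R} (C : set X).
Implicit Types (P Q K : X -> X) (x y : X) (D : set X).

Record cone_contraction K : Prop := ConeContraction {
  cc_linear : linear K;
  cc_pos : forall u, C u -> C (K u);
  cc_le : forall u, C u -> `|K u| <= `|u|
}.

Definition norm_dense D :=
  forall x (e : R), 0 < e -> exists2 z, D z & `|x - z| <= e.

Lemma cc_id : cone_contraction id.
Proof. by split. Qed.

Lemma cc_comp P Q : cone_contraction P -> cone_contraction Q ->
  cone_contraction (P \o Q).
Proof.
move=> [lP pP nP] [lQ pQ nQ]; split=> [a x y|u Cu|u Cu] /=.
- by rewrite lQ lP.
- exact/pP/pQ.
- by rewrite (le_trans (nP _ (pQ _ Cu)))// nQ.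
Qed.

Lemma cc_iter P n : cone_contraction P -> cone_contraction (iter n P).
Proof. by move=> cP; elim: n => [|n ih]; [exact: cc_id|exact: cc_comp cP ih]. Qed.

Context (hX : abstract_state_space C).

Lemma cc_combination (w : nat -> R) (P : nat -> X -> X) n :
  (forall k, 0 <= w k) -> \sum_(0 <= k < n) w k <= 1 ->
  (forall k, cone_contraction (P k)) ->
  cone_contraction (fun x => \sum_(0 <= k < n) w k *: P k x).
Proof.
move=> w0 w1 cP; split=> [a x y|u Cu|u Cu].
- rewrite scaler_sumr -big_split/=; apply: eq_bigr => k _.
  by rewrite (cc_linear (cP k)); lmodule.
- apply: big_ind => [|x y|k _]; [exact: cone0 hX|exact: cone_add|].
  by apply: cone_scale => //; exact: cc_pos.
- rewrite (le_trans (ler_norm_sum _ _ _))// (@le_trans _ _ (\sum_(0 <= k < n) w k * `|u|))//.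
    by apply: ler_sum => k _; rewrite norm_scale_ge0// ler_wpM2l// (cc_le (cP k)).
  by rewrite -mulr_suml ler_piMl.
Qed.

Lemma cc_limn (F : nat -> X -> X) K : (forall n, cone_contraction (F n)) ->
  (forall x, F n x @[n --> \oo] --> K x) -> cone_contraction K.
Proof.
move=> cF FK; split=> [a x y|u Cu|u Cu].
- have h : (a *: F n x + F n y) @[n --> \oo] --> a *: K x + K y.
    by apply: cvgD => //; exact: cvgZr.
  rewrite (_ : (fun n => _) = (fun n => F n (a *: x + y))) in h.
    exact: (cvg_unique _ (FK _) h).
  by apply/funext => n; rewrite (cc_linear (cF n)).
- by apply: (cone_limn hX _ (FK u)) => n; exact: (cc_pos (cF n)).
- apply: (cvgr_to_le (cvg_norm (FK u))); near=> n; exact: (cc_le (cF n)).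
Unshelve. all: by end_near.
Qed.

(* The norm of a cone contraction on the whole space is only controlled up to
   the constant with which [X] decomposes along its cone. *)
Definition cone_bound : R := s2val (cid2 (cone_decomposition hX)).
Local Notation M := cone_bound.

Lemma cone_bound_gt0 : 0 < M.
Proof. by rewrite /M; case: cid2. Qed.

Lemma cc_norm K x : cone_contraction K -> `|K x| <= M * `|x|.
Proof.
rewrite /M; case: cid2 => m /= m0 /(_ x)[u [v [Cu Cv -> uvm]]] cK.
rewrite (linear_mapB (cc_linear cK)) (le_trans (ler_normB _ _))//.
by rewrite (le_trans _ uvm)// lerD// cc_le.
Qed.

Lemma cc_continuous K : cone_contraction K -> continuous K.
Proof.
move=> cK x; apply/cvgrPdist_le => e e0; near=> y.
rewrite -(linear_mapB (cc_linear cK)) (le_trans (cc_norm _ cK))//.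
rewrite mulrC -ler_pdivlMr ?cone_bound_gt0//.
near: y; apply: cvgr_dist_le; first exact: cvg_id.
by rewrite divr_gt0 ?cone_bound_gt0.
Unshelve. all: by end_near.
Qed.

(** The bound [M], common to all cone contractions, makes [F] equicontinuous, so operators and
    arguments may converge together. *)
Lemma cc_cvgn_apply (F : nat -> X -> X) (u : nat -> X) x y :
  (forall n, cone_contraction (F n)) -> F n x @[n --> \oo] --> y ->
  u n @[n --> \oo] --> x -> F n (u n) @[n --> \oo] --> y.
Proof.
move=> cF /cvgrPdist_le Fx /cvgrPdist_le ux; apply/cvgrPdist_le => e e0.
have M0 := cone_bound_gt0.
have e1 : 0 < e / 2 / M by rewrite !divr_gt0.
have e2 : 0 < e / 2 by rewrite divr_gt0.
near=> n.
have -> : y - F n (u n) = (y - F n x) + F n (x - u n).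
  by rewrite (linear_mapB (cc_linear (cF n))) addrA subrK.
rewrite (le_trans (ler_normD _ _))// [leRHS](splitr e) lerD//.
  by near: n; exact: Fx.
rewrite (le_trans (cc_norm _ (cF n)))// mulrC -ler_pdivlMr//.
by near: n; exact: ux.
Unshelve. all: by end_near.
Qed.

Lemma cc_cvgn_dense (F : nat -> X -> X) D : norm_dense D ->
  (forall n, cone_contraction (F n)) -> (forall x, D x -> cvgn (F^~ x)) ->
  forall x, cvgn (F^~ x).
Proof.
move=> dD cF FD x; apply: cauchy_tail_cvgn => e e0.
have M0 := cone_bound_gt0.
have e1 : 0 < e / 4 / M by rewrite !divr_gt0.
have e2 : 0 < e / 4 by rewrite divr_gt0.
have [z Dz xz] := dD x _ e1.
have /cvgn_dist_le/(_ _ e2)[N hN] := FD z Dz.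
exists N => n Nn; have := hN n Nn; have := hN N (leqnn N).
set l := limn _ => hNl hnl.
have -> : F n x - F N x =
    F n (x - z) - F N (x - z) + ((F n z - l) - (F N z - l)).
  rewrite (linear_mapB (cc_linear (cF n))) (linear_mapB (cc_linear (cF N))).
  by lmodule.
have Fxz k : `|F k (x - z)| <= e / 4.
  by rewrite (le_trans (cc_norm _ (cF k)))// mulrC -ler_pdivlMr.
have := Fxz n; have := Fxz N.
have := ler_normD (F n (x - z) - F N (x - z)) ((F n z - l) - (F N z - l)).
have := ler_normB (F n (x - z)) (F N (x - z)).
have := ler_normB (F n z - l) (F N z - l).
lra.
Qed.

(** Telescoping of [P ^ m - Q ^ m] into [m] terms, each a cone contraction applied to
    [P x - Q x]. *)
Lemma norm_iter_sub P Q m x : cone_contraction P -> cone_contraction Q ->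
  (forall y, P (Q y) = Q (P y)) ->
  `|iter m P x - iter m Q x| <= m%:R * (M * `|P x - Q x|).
Proof.
move=> cP cQ PQ.
have iPQ k y : iter k P (Q y) = Q (iter k P y).
  by elim: k => //= k ->; rewrite PQ.
(* The outer map [K] collects the factors already split off: [M] may exceed 1, and bounding [Q] at
   each stage would accumulate powers of [M], whereas a composite costs a single [M]. *)
suff gen K : cone_contraction K ->
    `|K (iter m P x - iter m Q x)| <= m%:R * (M * `|P x - Q x|).
  exact: gen cc_id.
elim: m K => [|m ih] K cK.
  by rewrite subrr (linear_map0 (cc_linear cK)) normr0 mul0r.
have -> : K (iter m.+1 P x - iter m.+1 Q x) =
    (K \o iter m P) (P x - Q x) + (K \o Q) (iter m P x - iter m Q x).
  rewrite /= (linear_mapB (cc_linear (cc_iter m cP))) -iterSr /= iPQ.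
  rewrite (linear_mapB (cc_linear cQ)) !(linear_mapB (cc_linear cK)).
  by lmodule.
rewrite (le_trans (ler_normD _ _))// -natr1 mulrDl mul1r addrC lerD//.
  by apply: ih; exact: cc_comp.
by apply: cc_norm; apply: cc_comp => //; exact: cc_iter.
Qed.

End ConeContractions.

(** * Abel means of the powers of a cone contraction *)

Section AbelMeans.
Context {R : realType} {X : completeNormedModType R} (C : set X)
  (hX : abstract_state_space C).
Implicit Types (P S : X -> X) (x y : X) (q e : R).
Local Notation M := (cone_bound hX).

Definition abel_sum q P n x : X :=
  \sum_(0 <= k < n) ((1 - q) * q ^+ k) *: iter k P x.

(* [(1 - q) (1 - q P)^-1] *)
Definition abel_mean q P x : X := limn (fun n => abel_sum q P n x).

Lemma abel_sumS q P n x :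
  abel_sum q P n.+1 x = abel_sum q P n x + ((1 - q) * q ^+ n) *: iter n P x.
Proof. by rewrite /abel_sum big_nat_recr. Qed.

Lemma abel_sum0 q P x : abel_sum q P 0 x = 0.
Proof. by rewrite /abel_sum big_geq. Qed.

Lemma sum_abel_weights q n :
  \sum_(0 <= k < n) ((1 - q) * q ^+ k) = 1 - q ^+ n.
Proof.
elim: n => [|n ih]; first by rewrite big_geq// expr0 subrr.
by rewrite big_nat_recr//= ih exprS; ring.
Qed.

Context (q : R) (P : X -> X) (q0 : 0 <= q) (q1 : q < 1)
  (cP : cone_contraction C P).

Lemma abel_weight_ge0 k : 0 <= (1 - q) * q ^+ k.
Proof. by rewrite mulr_ge0 ?exprn_ge0// subr_ge0 ltW. Qed.

Lemma cc_abel_sum n : cone_contraction C (abel_sum q P n).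
Proof.
apply: (cc_combination hX); [exact: abel_weight_ge0| |by move=> k; exact: cc_iter].
by rewrite sum_abel_weights gerBl exprn_ge0.
Qed.

Lemma abel_mean_cvgn x : abel_sum q P n x @[n --> \oo] --> abel_mean q P x.
Proof.
suff Ccvg u : C u -> cvgn (fun n => abel_sum q P n u).
  have [u [v [Cu Cv ->]]] := cone_generating hX x.
  rewrite /abel_mean (_ : (fun n => _) =
    (fun n => abel_sum q P n u - abel_sum q P n v)).
    exact: is_cvgB (Ccvg u Cu) (Ccvg v Cv).
  by apply/funext => n; rewrite (linear_mapB (cc_linear (cc_abel_sum n))).
move=> Cu; apply: (cone_incr_cvgn hX (b := `|u|)) => [|n|n].
- by rewrite abel_sum0; exact: cone0 hX.
- rewrite abel_sumS addrAC subrr add0r; apply: (cone_scale hX).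
    exact: abel_weight_ge0.
  by apply: (cc_pos (cc_iter n cP)).
- exact: (cc_le (cc_abel_sum n)).
Qed.

Lemma cc_abel_mean : cone_contraction C (abel_mean q P).
Proof. exact: (cc_limn hX cc_abel_sum abel_mean_cvgn). Qed.

Let linK := cc_linear cc_abel_mean.

Lemma abel_mean_left_inverse x : abel_mean q P (x - q *: P x) = (1 - q) *: x.
Proof.
have sumE n : abel_sum q P n (x - q *: P x) =
    (1 - q) *: (x - q ^+ n *: iter n P x).
  elim: n => [|n ih]; first by rewrite abel_sum0 expr0 scale1r subrr scaler0.
  have linPn := cc_linear (cc_iter n cP).
  rewrite abel_sumS ih (linear_mapB linPn) (linear_mapZ linPn) -iterSr.
  by rewrite exprS; lmodule.
have qn0 : q ^+ n *: iter n P x @[n --> \oo] --> 0.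
  apply/norm_cvg0P; apply: (@squeeze_cvgr _ _ _ _ (fun=> 0) (geometric (M * `|x|) q)).
  - near=> n; rewrite normr_ge0 /= norm_scale_ge0 ?exprn_ge0// mulrC.
    by rewrite ler_wpM2r ?exprn_ge0//; exact: cc_norm (cc_iter n cP).
  - exact: cvg_cst.
  - by apply: cvg_geometric; rewrite ger0_norm.
have h : abel_sum q P n (x - q *: P x) @[n --> \oo] --> (1 - q) *: (x - 0).
  under eq_fun do rewrite sumE.
  by apply: cvgZr; apply: cvgB => //; exact: cvg_cst.
rewrite subr0 in h; exact: (cvgn_unique (@abel_mean_cvgn _) h).
Unshelve. all: by end_near.
Qed.

Lemma abel_mean_commute S : cone_contraction C S ->
  (forall x, S (P x) = P (S x)) ->
  forall x, S (abel_mean q P x) = abel_mean q P (S x).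
Proof.
move=> cS SP x.
have SPk k y : S (iter k P y) = iter k P (S y) by elim: k => //= k <-; rewrite SP.
have h : abel_sum q P n (S x) @[n --> \oo] --> S (abel_mean q P x).
  rewrite (_ : (fun n => abel_sum q P n (S x)) = (fun n => S (abel_sum q P n x))).
    exact: (cc_cvgn_apply hX (fun=> cS) (cvg_cst _) (@abel_mean_cvgn x)).
  apply/funext => n; rewrite /abel_sum (linear_map_sum (cc_linear cS)).
  by apply: eq_bigr => k _; rewrite (linear_mapZ (cc_linear cS)) SPk.
exact: (cvgn_unique h (@abel_mean_cvgn _)).
Qed.

(** The tail of the series from rank [n] on is the mean of [q ^ n P ^ n x]; subtracting it leaves
    the first [n] terms. *)
Lemma abel_mean_sub_iter n x :
  abel_mean q P (x - q ^+ n *: iter n P x) = abel_sum q P n x.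
Proof.
elim: n => [|n ih].
  by rewrite abel_sum0 expr0 scale1r subrr (linear_map0 linK).
have -> : x - q ^+ n.+1 *: iter n.+1 P x = (x - q ^+ n *: iter n P x) +
    q ^+ n *: (iter n P x - q *: P (iter n P x)).
  by rewrite /= exprS; lmodule.
rewrite (linear_mapD linK) ih (linear_mapZ linK) abel_mean_left_inverse.
by rewrite abel_sumS scalerA (mulrC (q ^+ n)).
Qed.

Lemma norm_abel_sum_sub n x e :
  (forall j, (j < n)%N -> `|iter j P x - x| <= e) ->
  `|abel_sum q P n x - (1 - q ^+ n) *: x| <= (1 - q ^+ n) * e.
Proof.
elim: n => [|n ih] h.
  by rewrite abel_sum0 expr0 subrr scale0r subrr normr0 mul0r.
rewrite abel_sumS.
have -> : abel_sum q P n x + ((1 - q) * q ^+ n) *: iter n P x -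
    (1 - q ^+ n.+1) *: x = (abel_sum q P n x - (1 - q ^+ n) *: x) +
    ((1 - q) * q ^+ n) *: (iter n P x - x) by rewrite exprS; lmodule.
rewrite (le_trans (ler_normD _ _))//.
have -> : (1 - q ^+ n.+1) * e = (1 - q ^+ n) * e + (1 - q) * q ^+ n * e.
  by rewrite exprS; ring.
rewrite lerD//; first by apply: ih => j jn; apply: h; exact: ltnW.
by rewrite norm_scale_ge0 ?abel_weight_ge0// ler_wpM2l ?abel_weight_ge0// h.
Qed.

End AbelMeans.

Lemma iter_iter (T : Type) (f : T -> T) m n x :
  iter m (iter n f) x = iter (m * n) f x.
Proof. by elim: m => //= m ->; rewrite mulSn iterD. Qed.

(** * Abel means on a refined time grid *)

Section AbelMeanRefinement.
Context {R : realType} {X : completeNormedModType R} (C : set X)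
  (hX : abstract_state_space C) (q : R) (P : X -> X) (q0 : 0 <= q) (q1 : q < 1)
  (cP : cone_contraction C P).

(** Grouping the powers of [P] in blocks of length [n] writes the mean as the coarse mean, with
    [q ^ n] and [P ^ n], of the normalised first block. That block averages the points [iter j P x],
    all within [e] of [x], and the coarse mean costs a factor [M]. *)
Lemma norm_abel_mean_refine n x e : (0 < n)%N ->
  (forall j, (j < n)%N -> `|iter j P x - x| <= e) ->
  `|abel_mean q P x - abel_mean (q ^+ n) (iter n P) x| <= cone_bound hX * e.
Proof.
move=> n0 h.
have qn0 : 0 <= q ^+ n by rewrite exprn_ge0.
have qn1 : q ^+ n < 1 by rewrite exprn_ilt1// -lt0n.
have cPn := cc_iter n cP.
have cK := cc_abel_mean hX qn0 qn1 cPn.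
have refine : abel_mean (q ^+ n) (iter n P) (abel_sum q P n x) =
    (1 - q ^+ n) *: abel_mean q P x.
  rewrite -(abel_mean_left_inverse hX qn0 qn1 cPn) -(abel_mean_sub_iter hX q0 q1 cP).
  have cKq := cc_abel_mean hX q0 q1 cP.
  rewrite (linear_mapB (cc_linear cKq)) (linear_mapZ (cc_linear cKq)).
  congr (abel_mean _ _ (_ - _ *: _)).
  rewrite (abel_mean_commute hX q0 q1 cP cPn)// => y.
  by rewrite -iterSr.
have d0 : 0 < 1 - q ^+ n by rewrite subr_gt0.
rewrite -(ler_pM2l d0) -(norm_scale_ge0 _ (ltW d0)) scalerBr -refine.
rewrite -(linear_mapZ (cc_linear cK)) -(linear_mapB (cc_linear cK)).
rewrite (le_trans (cc_norm hX _ cK))// mulrCA.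
rewrite (ler_pM2l (cone_bound_gt0 hX)).
exact: norm_abel_sum_sub.
Qed.

End AbelMeanRefinement.

(** * Slope of the exponential and dyadic grids *)

Section RealLimits.
Context {R : realType}.

Lemma near_at_right0 (P : R -> Prop) : (\forall t \near 0^'+, P t) <->
  exists2 d : R, 0 < d & forall t, 0 < t -> t <= d -> P t.
Proof.
split=> [/nbhs_ballP[d /= d0 hd]|[d d0 hd]].
  exists (d / 2) => [|t t0 td]; first by rewrite divr_gt0.
  apply: hd => //; rewrite /ball/= sub0r normrN gtr0_norm//; lra.
near=> t; apply: hd; near: t; [exact: nbhs_right_gt|exact: nbhs_right_le].
Unshelve. all: by end_near.
Qed.

Lemma cvg_expR_mul_at_right0 (c : R) : expR (c * h) @[h --> 0^'+] --> (1 : R).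
Proof.
have ch : c * h @[h --> 0^'+] --> c * 0.
  by apply: cvgMr; apply: cvg_at_right_filter; exact: cvg_id.
by have := cvg_comp _ _ ch (@continuous_expR R (c * 0)); rewrite mulr0 expR0.
Qed.

(* [x <= e^x - 1 <= x e^x] *)
Lemma cvg_expR_slope (c : R) : h^-1 * (expR (c * h) - 1) @[h --> 0^'+] --> c.
Proof.
apply: (@squeeze_cvgr _ _ _ _ (fun=> c) (fun h => c * expR (c * h))).
- apply/near_at_right0; exists 1 => // h h0 _.
  rewrite ler_pdivlMl// ler_pdivrMl//; apply/andP; split.
    by have := expR_ge1Dx (c * h); lra.
  have := expR_ge1Dx (- (c * h)); rewrite -(ler_pM2r (expR_gt0 (c * h))).
  by rewrite expRN mulVf ?gt_eqF ?expR_gt0//; lra.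
- exact: cvg_cst.
- by rewrite -[X in _ --> X]mulr1; apply: cvgMr; exact: cvg_expR_mul_at_right0.
Qed.

Definition dyadic_step n : R := (2 ^+ n)^-1.

Lemma dyadic_step_gt0 n : 0 < dyadic_step n.
Proof. by rewrite invr_gt0 exprn_gt0. Qed.

Lemma dyadic_step_cvg0 : dyadic_step n @[n --> \oo] --> (0 : R).
Proof.
rewrite (_ : dyadic_step = geometric 1 2^-1).
  by apply: cvg_geometric; rewrite gtr0_norm// invf_lt1// ltr1n.
by apply/funext => n; rewrite /= exprVn mul1r.
Qed.

Lemma dyadic_step_cvg_right : dyadic_step n @[n --> \oo] --> (0 : R)^'+.
Proof.
move=> P /near_at_right0[d d0 hd].
have /cvgrPdist_le/(_ d d0) := dyadic_step_cvg0.
apply: filterS => n; rewrite sub0r normrN (gtr0_norm (dyadic_step_gt0 n)).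
exact/hd/dyadic_step_gt0.
Qed.

Lemma dyadic_step_small (d : R) : 0 < d -> exists N, forall n, (N <= n)%N ->
  dyadic_step n <= d.
Proof.
move=> d0; have /cvgrPdist_le/(_ d d0)[N _ hN] := dyadic_step_cvg0.
exists N => n /hN; rewrite /= sub0r normrN (gtr0_norm (dyadic_step_gt0 n)).
exact.
Qed.

Lemma dyadic_step_refine m n : (m <= n)%N ->
  dyadic_step m = (2 ^ (n - m))%:R * dyadic_step n.
Proof.
move=> mn; rewrite /dyadic_step -{2}(subnK mn) exprD natrX invfM mulrA divff ?mul1r//.
Qed.

Definition dyadic_floor (t : R) n : nat := Num.truncn (t / dyadic_step n).

Lemma dyadic_floor_le t n : 0 <= t -> (dyadic_floor t n)%:R * dyadic_step n <= t.
Proof.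
move=> t0; rewrite -ler_pdivlMr ?dyadic_step_gt0// truncn_le.
by rewrite divr_ge0// ltW// dyadic_step_gt0.
Qed.

Lemma dyadic_floor_gt t n :
  t - (dyadic_floor t n)%:R * dyadic_step n <= dyadic_step n.
Proof.
have h0 := dyadic_step_gt0 n.
rewrite lerBlDr -[X in X + _]mul1r -mulrDl nat1r -ler_pdivrMr//.
by rewrite ltW// truncnS_gt.
Qed.

Lemma dyadic_floor_cvg t : 0 <= t ->
  (dyadic_floor t n)%:R * dyadic_step n @[n --> \oo] --> t.
Proof.
move=> t0; apply/cvgrPdist_le => e e0.
have /cvgrPdist_le/(_ e e0) := dyadic_step_cvg0.
apply: filterS => n; rewrite sub0r normrN gtr0_norm ?dyadic_step_gt0//.
rewrite ger0_norm ?subr_ge0 ?dyadic_floor_le//.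
exact/le_trans/dyadic_floor_gt.
Qed.

End RealLimits.

(** * Laplace transform of a substochastic semigroup *)

Section SemigroupLaplace.
Context {R : realType} {X : completeNormedModType R} (C : set X)
  (hX : abstract_state_space C) (T : R -> X -> X) (hT : substochastic C T).
Implicit Types (x y z : X) (s t h e : R).
Local Notation M := (cone_bound hX).
Local Notation step := (@dyadic_step R).

Let hT0 := substochastic_C0 hT.

Lemma cc_semigroup t : 0 <= t -> cone_contraction C (T t).
Proof.
move=> t0; split.
- exact: semigroup_linear hT0 _ t0.
- by move=> u; exact: substochastic_pos hT _ _ t0.
- by move=> u; exact: substochastic_contr hT _ _ t0.
Qed.

Lemma iter_semigroup k h x : 0 <= h -> iter k (T h) x = T (k%:R * h) x.
Proof.
move=> h0; elim: k => [|k ih]; first by rewrite mul0r (semigroup0 hT0).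
by rewrite iterS ih -(semigroupD hT0)// ?mulr_ge0// -[X in X + _]mul1r -mulrDl nat1r.
Qed.

Lemma semigroup_commute s t x : 0 <= s -> 0 <= t -> T s (T t x) = T t (T s x).
Proof. by move=> s0 t0; rewrite -!(semigroupD hT0)// addrC. Qed.

Lemma semigroup_near0 x e : 0 < e -> exists2 d : R, 0 < d &
  forall r, 0 <= r -> r <= d -> `|T r x - x| <= e.
Proof.
move=> e0; have /cvgrPdist_le/(_ e e0)/near_at_right0[d d0 hd] := @semigroup_cvg0 _ _ _ hT0 x.
exists d => // r; rewrite le_eqVlt => /predU1P[<- _|r0 rd].
  by rewrite (semigroup0 hT0) subrr normr0 ltW.
by rewrite distrC hd.
Qed.

(** Strong continuity is given at 0 only. It suffices because
    [T t x - T r x = T r (T (t - r) x - x)] for [0 <= r <= t], and every [T r] is bounded by [M]. *)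
Lemma semigroup_dyadic_floor_cvg t x : 0 <= t ->
  T ((dyadic_floor t n)%:R * step n) x @[n --> \oo] --> T t x.
Proof.
move=> t0; apply/cvgn_dist_le => e e0.
have M0 := cone_bound_gt0 hX.
have [d d0 hd] := @semigroup_near0 x (e / M) (divr_gt0 e0 M0).
have [N hN] := dyadic_step_small d0.
exists N => n Nn; set r := _ * step n.
have r0 : 0 <= r by rewrite mulr_ge0// ltW// dyadic_step_gt0.
have rt : 0 <= t - r by rewrite subr_ge0 dyadic_floor_le.
have -> : T r x - T t x = - T r (T (t - r) x - x).
  rewrite (linear_mapB (cc_linear (cc_semigroup r0))) -(semigroupD hT0)//.
  by rewrite (addrC r) subrK opprB.
rewrite normrN (le_trans (cc_norm hX _ (cc_semigroup r0)))// mulrC -ler_pdivlMr//.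
by rewrite hd// (le_trans (dyadic_floor_gt t n))// hN.
Qed.

Context (lam : R) (lam_gt0 : 0 < lam).
Let q h : R := expR (- lam * h).

Let q_ge0 h : 0 <= q h. Proof. exact/ltW/expR_gt0. Qed.
Let q_lt1 h : 0 < h -> q h < 1.
Proof. by move=> h0; rewrite expR_lt1 mulNr oppr_lt0 mulr_gt0. Qed.

Let abel n := abel_mean (q (step n)) (T (step n)).

Let step_ge0 n : 0 <= step n. Proof. exact/ltW/dyadic_step_gt0. Qed.

Let cc_abel n : cone_contraction C (abel n).
Proof.
apply: (cc_abel_mean hX) => //; first exact/q_lt1/dyadic_step_gt0.
exact: cc_semigroup.
Qed.

(* Limit of Riemann sums of [lam * \int_0^oo exp (- lam * t) T(t) x dt]. *)
Definition laplace_mean x : X := limn (fun n =>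
  abel_mean (expR (- lam * step n)) (T (step n)) x).

(** Dyadic grids are nested: [abel N] is an Abel mean of [T (step n)] raised to the power
    [2 ^ (n - N)], so the refinement estimate bounds its distance to [abel n] by the oscillation of
    [T] near time 0. *)
Lemma laplace_mean_cvgn x : abel n x @[n --> \oo] --> laplace_mean x.
Proof.
apply: cauchy_tail_cvgn => e e0.
have M0 := cone_bound_gt0 hX.
have [d d0 hd] := @semigroup_near0 x (e / M) (divr_gt0 e0 M0).
have [N hN] := dyadic_step_small d0.
exists N => n Nn.
have stepE := @dyadic_step_refine R _ _ Nn.
have -> : abel N =
    abel_mean (q (step n) ^+ (2 ^ (n - N))) (iter (2 ^ (n - N)) (T (step n))).
  rewrite /abel; congr abel_mean; first by rewrite /q stepE mulrCA expRM_natl.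
  by apply/funext => y; rewrite iter_semigroup// stepE.
have -> : e = M * (e / M) by rewrite mulrC divfK// gt_eqF.
apply: norm_abel_mean_refine => //; first exact/q_lt1/dyadic_step_gt0.
- exact: cc_semigroup.
- by rewrite expn_gt0.
move=> j jn; rewrite iter_semigroup//; apply: hd; first by rewrite mulr_ge0.
apply: le_trans (hN N (leqnn N)); rewrite stepE ler_wpM2r// ler_nat ltnW//.
Qed.

Lemma cc_laplace_mean : cone_contraction C laplace_mean.
Proof. exact: (cc_limn hX cc_abel laplace_mean_cvgn). Qed.

Let linK := cc_linear cc_laplace_mean.

Lemma laplace_mean_commute t x : 0 <= t ->
  T t (laplace_mean x) = laplace_mean (T t x).
Proof.
move=> t0; have h : abel n (T t x) @[n --> \oo] --> T t (laplace_mean x).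
  rewrite (_ : (fun n => abel n (T t x)) = (fun n => T t (abel n x))).
    exact: (cc_cvgn_apply hX (fun=> cc_semigroup t0) (cvg_cst _) (@laplace_mean_cvgn x)).
  apply/funext => n; rewrite (abel_mean_commute hX)//.
  - exact/q_lt1/dyadic_step_gt0.
  - exact: cc_semigroup.
  - exact: cc_semigroup.
  - by move=> y; rewrite semigroup_commute.
exact: (cvgn_unique h (@laplace_mean_cvgn _)).
Qed.

(** The Laplace mean of [x - q s *: T s x] stands for the integral of [lam exp (- lam t) T(t) x]
    over [[0, s]], whose weight has mass [1 - q s]. At multiples of the dyadic step its approximants
    are finite Abel sums; a general [s] is reached through [dyadic_floor]. *)
Lemma laplace_mean_shift x d e s :
  (forall r, 0 <= r -> r <= d -> `|T r x - x| <= e) -> 0 <= s -> s <= d ->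
  `|laplace_mean (x - q s *: T s x) - (1 - q s) *: x| <= (1 - q s) * e.
Proof.
move=> hd s0 sd; pose t n := (dyadic_floor s n)%:R * step n.
have t0 n : 0 <= t n by rewrite mulr_ge0.
have ts n : t n <= s by exact: dyadic_floor_le.
have tcvg : t n @[n --> \oo] --> s by exact: dyadic_floor_cvg.
have qcvg : q (t n) @[n --> \oo] --> q s.
  have lt : - lam * t n @[n --> \oo] --> - lam * s by apply: cvgMr.
  exact: (cvg_comp _ _ lt (@continuous_expR R _)).
have lcvg : `|abel n (x - q (t n) *: T (t n) x) - (1 - q (t n)) *: x| @[n --> \oo]
    --> `|laplace_mean (x - q s *: T s x) - (1 - q s) *: x|.
  apply: cvg_norm; apply: cvgB; last first.
    by apply: cvgZl; apply: cvgB => //; exact: cvg_cst.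
  apply: (cc_cvgn_apply hX cc_abel (@laplace_mean_cvgn _)).
  apply: cvgB; first exact: cvg_cst.
  by apply: cvgZ => //; exact: semigroup_dyadic_floor_cvg.
have rcvg : (1 - q (t n)) * e @[n --> \oo] --> (1 - q s) * e.
  by apply: cvgMl; apply: cvgB => //; exact: cvg_cst.
apply: (ler_cvg_to lcvg rcvg); near=> n.
have qE : q (t n) = q (step n) ^+ dyadic_floor s n.
  by rewrite /q /t mulrCA expRM_natl.
have TE : T (t n) x = iter (dyadic_floor s n) (T (step n)) x by rewrite iter_semigroup.
rewrite TE qE /abel (abel_mean_sub_iter hX)//; last 2 first.
- exact/q_lt1/dyadic_step_gt0.
- exact: cc_semigroup.
apply: norm_abel_sum_sub => //; first exact/q_lt1/dyadic_step_gt0.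
move=> j jn; rewrite iter_semigroup//; apply: hd; first by rewrite mulr_ge0.
apply: le_trans sd; apply: le_trans (ts n).
by rewrite ler_wpM2r// ler_nat ltnW.
Unshelve. all: by end_near.
Qed.

(** Deviation from [x] of the average of its orbit over [[0, h]] with weight proportional to
    [exp (- lam t)]. *)
Let defect x h : X := (1 - q h)^-1 *: laplace_mean (x - q h *: T h x) - x.

Lemma laplace_defect_cvg0 x : defect x h @[h --> 0^'+] --> 0.
Proof.
apply/norm_cvg0P/cvgrPdist_le => e e0; apply/near_at_right0.
have [d d0 hd] := semigroup_near0 x e0.
exists d => // h h0 hd'; rewrite sub0r normrN normr_id.
have qh : 0 < 1 - q h by rewrite subr_gt0 q_lt1.
rewrite -(ler_pM2l qh) -(norm_scale_ge0 _ (ltW qh)).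
rewrite scalerBr scalerA divff ?gt_eqF// scale1r.
exact: laplace_mean_shift (ltW h0) hd'.
Qed.

Lemma laplace_mean_dense : norm_dense (range laplace_mean).
Proof.
move=> x e e0; have /cvgrPdist_le/(_ e e0)/near_at_right0[d d0 hd] := @laplace_defect_cvg0 x.
exists (laplace_mean ((1 - q d)^-1 *: (x - q d *: T d x))); first by eexists.
have := hd d d0 (lexx d); rewrite sub0r /defect opprB.
by rewrite (linear_mapZ linK).
Qed.

Lemma laplace_mean_derivative x :
  h^-1 *: (T h (laplace_mean x) - laplace_mean x) @[h --> 0^'+]
    --> lam *: (laplace_mean x - x).
Proof.
(* For [h > 0] the expression under this limit equals the difference quotient exactly,
   [expR (lam * h)] being the inverse of [q h]. *)
have cv : (h^-1 * (expR (lam * h) - 1)) *: (laplace_mean x - x - defect x h)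
    @[h --> 0^'+] --> lam *: (laplace_mean x - x - 0).
  apply: cvgZ; first exact: cvg_expR_slope.
  by apply: cvgB; [exact: cvg_cst|exact: laplace_defect_cvg0].
rewrite subr0 in cv; apply: cvg_trans cv; apply: near_eq_cvg.
apply/near_at_right0; exists 1 => // h h0 _.
have qh : 0 < 1 - q h by rewrite subr_gt0 q_lt1.
have q0 : 0 < q h by exact: expR_gt0.
have -> : expR (lam * h) = (q h)^-1 by rewrite /q mulNr expRN invrK.
rewrite laplace_mean_commute ?ltW// /defect (linear_mapB linK) (linear_mapZ linK).
set y := laplace_mean x; set z := laplace_mean (T h x).
have -> : y - x - ((1 - q h)^-1 *: (y - q h *: z) - x) =
    (1 - q h)^-1 *: ((1 - q h) *: y - (y - q h *: z)).
  by rewrite [in RHS]scalerBr [in RHS]scalerA mulVf ?gt_eqF// scale1r; lmodule.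
rewrite scalerA -mulrA.
have -> : ((q h)^-1 - 1) * (1 - q h)^-1 = (q h)^-1 by field; rewrite !gt_eqF.
have -> : (1 - q h) *: y - (y - q h *: z) = q h *: (z - y) by lmodule.
by rewrite scalerA -mulrA mulVf ?gt_eqF// mulr1.
Qed.

(** At step [h] the Abel mean sends [h^-1 *: (y - q h *: T h y)] exactly to
    [(h^-1 * (1 - q h)) *: y]. Along the dyadic steps the arguments tend to [lam *: y - z] and the
    values to [lam *: y]. *)
Lemma laplace_mean_left_inverse y z :
  h^-1 *: (T h y - y) @[h --> 0^'+] --> z -> laplace_mean (lam *: y - z) = lam *: y.
Proof.
move=> yz.
have slope : (h^-1 * (1 - q h)) *: y @[h --> 0^'+] --> lam *: y.
  apply: cvgZl; rewrite -[X in _ --> X]opprK.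
  rewrite (_ : (fun h => _) = (fun h => - (h^-1 * (expR (- lam * h) - 1)))).
    by apply: cvgN; exact: cvg_expR_slope.
  by apply/funext => h; rewrite -mulrN opprB.
have arg : ((h^-1 * (1 - q h)) *: y - q h *: (h^-1 *: (T h y - y))) @[h --> 0^'+]
    --> lam *: y - 1 *: z.
  apply: cvgB => //; apply: cvgZ => //; exact: cvg_expR_mul_at_right0.
rewrite scale1r in arg.
have argn := cvg_comp _ _ (@dyadic_step_cvg_right R) arg.
have slopen := cvg_comp _ _ (@dyadic_step_cvg_right R) slope.
have := cc_cvgn_apply hX cc_abel (@laplace_mean_cvgn _) argn.
rewrite (_ : (fun n => _) = (fun h => (h^-1 * (1 - q h)) *: y) \o step).
  by move=> h; exact: (cvgn_unique h slopen).
apply/funext => n /=; set h := step n.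
have -> : (h^-1 * (1 - q h)) *: y - q h *: (h^-1 *: (T h y - y)) =
    h^-1 *: (y - q h *: T h y) by lmodule.
rewrite (linear_mapZ (cc_linear (cc_abel n))) /abel (abel_mean_left_inverse hX)//.
- by rewrite scalerA.
- exact/q_lt1/dyadic_step_gt0.
- exact: cc_semigroup.
Qed.

End SemigroupLaplace.

(** * Arithmetic of partially defined linear operators *)

Section OperatorLinearity.
Context {R : realType} {X : completeNormedModType R} (G : operator X).
Implicit Types (x y : X) (a : R).

Lemma op0 : G 0 = 0.
Proof.
have := op_linear (-1) (dom_zero G) (dom_zero G).
by rewrite scaleN1r oppr0 addr0 scaleN1r addNr.
Qed.

Lemma domZ a x : dom G x -> dom G (a *: x).
Proof.
by move=> Gx; rewrite -[_ *: _]addr0; apply: dom_linear => //; exact: dom_zero.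
Qed.

Lemma opZ a x : dom G x -> G (a *: x) = a *: G x.
Proof.
by move=> Gx; rewrite -[_ *: _]addr0 op_linear ?op0 ?addr0//; exact: dom_zero.
Qed.

Lemma domD x y : dom G x -> dom G y -> dom G (x + y).
Proof. by move=> Gx Gy; rewrite -[x]scale1r; exact: dom_linear. Qed.

Lemma opD x y : dom G x -> dom G y -> G (x + y) = G x + G y.
Proof. by move=> Gx Gy; rewrite -{1}[x]scale1r op_linear// scale1r. Qed.

Lemma domB x y : dom G x -> dom G y -> dom G (x - y).
Proof. by move=> Gx Gy; rewrite -scaleN1r; apply: domD => //; exact: domZ. Qed.

Lemma opB x y : dom G x -> dom G y -> G (x - y) = G x - G y.
Proof.
move=> Gx Gy; rewrite -(scaleN1r y) opD ?opZ ?(scaleN1r (G y))//.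
exact: domZ.
Qed.

End OperatorLinearity.

(** * From implicit Euler steps to a semigroup *)

Section EulerFamilies.
Context {R : realType} {X : completeNormedModType R} (C : set X)
  (hX : abstract_state_space C).
Implicit Types (x y z : X) (s t h e : R) (G : operator X) (J : R -> X -> X).
Local Notation M := (cone_bound hX).
Local Notation step := (@dyadic_step R).

(* [J h = (1 - h G)^-1], the steps of the implicit Euler scheme of [u' = G u]. *)
Record euler_family G J : Prop := EulerFamily {
  euler_cc : forall h, 0 < h -> cone_contraction C (J h);
  euler_dom : forall h x, 0 < h -> dom G (J h x);
  euler_right : forall h x, 0 < h -> J h x - h *: G (J h x) = x;
  euler_left : forall h y, 0 < h -> dom G y -> J h (y - h *: G y) = y;
  euler_dense : norm_dense (dom G)
}.

Lemma generator_euler_family (S : R -> X -> X) (H : operator X) :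
  substochastic C S -> generates H S ->
  euler_family H (fun h => laplace_mean S h^-1).
Proof.
move=> hS [domE genE].
have deriv x h : 0 < h -> h'^-1 *: (S h' (laplace_mean S h^-1 x) - laplace_mean S h^-1 x)
    @[h' --> 0^'+] --> h^-1 *: (laplace_mean S h^-1 x - x).
  by move=> h0; apply: (laplace_mean_derivative hX hS); rewrite invr_gt0.
have domL x h : 0 < h -> dom H (laplace_mean S h^-1 x).
  by move=> h0; rewrite domE /=; apply/cvg_ex; eexists; exact: deriv.
split; [move=> h h0|move=> h x h0; exact: domL|move=> h x h0|move=> h y h0 Hy|].
- by apply: (cc_laplace_mean hX hS); rewrite invr_gt0.
- have -> : H (laplace_mean S h^-1 x) = h^-1 *: (laplace_mean S h^-1 x - x).
    exact: (cvg_unique _ (genE _ (domL x h h0)) (deriv x h h0)).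
  by rewrite scalerA divff ?gt_eqF// scale1r opprB (addrC _ (x - _)) subrK.
- have hi0 : 0 < h^-1 by rewrite invr_gt0.
  have linK := cc_linear (cc_laplace_mean hX hS hi0).
  have -> : y - h *: H y = h *: (h^-1 *: y - H y).
    by rewrite scalerBr scalerA divff ?gt_eqF// scale1r.
  rewrite (linear_mapZ linK) (laplace_mean_left_inverse hX hS hi0 (genE _ Hy)).
  by rewrite scalerA divff ?gt_eqF// scale1r.
- move=> x e e0; have [_ [y _ <-] xy] := laplace_mean_dense hX hS ltr01 x e0.
  by eexists; [|exact: xy]; rewrite -[X in laplace_mean _ X]invr1; exact: domL.
Qed.

Context (G : operator X) (J : R -> X -> X) (hJ : euler_family G J).

Let ccJ h : 0 < h -> cone_contraction C (J h). Proof. exact: euler_cc hJ _. Qed.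
Let M0 : 0 < M. Proof. exact: cone_bound_gt0. Qed.
Let M0' : 0 <= M. Proof. exact: ltW. Qed.

Lemma euler_step_sub h x : 0 < h -> dom G x -> J h x - x = h *: J h (G x).
Proof.
move=> h0 Gx; have := euler_left hJ h0 Gx.
rewrite (linear_mapB (cc_linear (ccJ h0))) (linear_mapZ (cc_linear (ccJ h0))) => xE.
by rewrite -{2}xE; lmodule.
Qed.

Lemma euler_op h x : 0 < h -> dom G x -> G (J h x) = J h (G x).
Proof.
move=> h0 Gx; apply: (scalerI (lt0r_neq0 h0)); rewrite -euler_step_sub//.
by rewrite -{3}(euler_right hJ x h0); lmodule.
Qed.

Lemma euler_commute h k x : 0 < h -> 0 < k -> J h (J k x) = J k (J h x).
Proof.
move=> h0 k0; have Gk := euler_dom hJ x k0.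
rewrite -(euler_left hJ k0 (euler_dom hJ (J k x) h0)) euler_op//.
rewrite -(linear_mapZ (cc_linear (ccJ h0))) -(linear_mapB (cc_linear (ccJ h0))).
by rewrite (euler_right hJ).
Qed.

(** On the domain, [j] steps move a point by at most a multiple of [j * h], by telescoping; density
    and the bound [M] extend this to a modulus of continuity at every [y], uniform in [h]. *)
Lemma euler_equicontinuous y e : 0 < e -> exists2 d : R, 0 < d &
  forall h j, 0 < h -> j%:R * h <= d -> `|iter j (J h) y - y| <= e.
Proof.
move=> e0; have e1 : 0 < e / 2 / (M + 1) by rewrite !divr_gt0 ?addr_gt0.
have [z Gz yz] := euler_dense hJ y e1.
(* One factor [M] comes from the telescoping, the other from [J h] acting on [G z]; the added 1
   keeps [c] positive. *)
pose c := M * (M * `|G z|) + 1.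
have c0 : 0 < c by apply: ltr_wpDl => //; rewrite !mulr_ge0.
exists (e / 2 / c) => [|h j h0 jh]; first by rewrite !divr_gt0.
have cj := cc_iter j (ccJ h0).
have -> : iter j (J h) y - y = iter j (J h) (y - z) + (iter j (J h) z - z) + (z - y).
  by rewrite (linear_mapB (cc_linear cj)); lmodule.
rewrite (le_trans (ler_normD _ _))// (distrC z).
have := ler_normD (iter j (J h) (y - z)) (iter j (J h) z - z).
have : `|iter j (J h) (y - z)| <= M * `|y - z| by exact: cc_norm.
have : (M + 1) * `|y - z| <= e / 2 by rewrite mulrC -ler_pdivlMr ?addr_gt0.
have : `|iter j (J h) z - z| <= e / 2; last lra.
have := norm_iter_sub hX j z (ccJ h0) (cc_id C) (fun _ => erefl).
rewrite (_ : iter j id z = z); last by elim: j {jh cj} => //= j ->.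
move=> /le_trans; apply; rewrite euler_step_sub// (norm_scale_ge0 _ (ltW h0)).
have jc : j%:R * h * c <= e / 2 by rewrite -ler_pdivlMr.
apply: le_trans jc; set a := `|J h (G z)|.
have -> : j%:R * (M * (h * a)) = j%:R * h * (M * a) by ring.
rewrite ler_wpM2l ?mulr_ge0 ?(ltW h0)//.
apply: (@le_trans _ _ (M * (M * `|G z|))); last by rewrite /c lerDl.
by rewrite ler_wpM2l//; exact: cc_norm (ccJ h0).
Qed.

(* [J h ^ m x - x - m h G x = h \sum_(1 <= j <= m) (J h ^ j - 1) G x] *)
Lemma euler_first_order m h x e : 0 < h -> dom G x ->
  (forall j, (j <= m)%N -> `|iter j (J h) (G x) - G x| <= e) ->
  `|iter m (J h) x - x - (m%:R * h) *: G x| <= m%:R * h * e.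
Proof.
move=> h0 Gx; elim: m => [|m ih] hj.
  by rewrite !mul0r scale0r subrr subr0 normr0.
have linJm := cc_linear (cc_iter m (ccJ h0)).
have -> : iter m.+1 (J h) x - x - (m.+1%:R * h) *: G x =
    (iter m (J h) x - x - (m%:R * h) *: G x) +
    h *: (iter m.+1 (J h) (G x) - G x).
  have -> : iter m.+1 (J h) x = iter m (J h) x + h *: iter m.+1 (J h) (G x).
    rewrite !iterSr -(linear_mapZ linJm) -(linear_mapD linJm) -euler_step_sub//.
    by rewrite addrC subrK.
  by rewrite -natr1; lmodule.
rewrite (le_trans (ler_normD _ _))// -natr1 2!mulrDl mul1r lerD//.
  by apply: ih => j jm; apply: hj; exact: leqW.
by rewrite (norm_scale_ge0 _ (ltW h0)) ler_pM2l//; exact: hj.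
Qed.

Definition euler_approx n t : X -> X := iter (dyadic_floor t n) (J (step n)).

Definition euler_semigroup t x : X := limn (fun n => euler_approx n t x).

Let step0 n : 0 < step n. Proof. exact: dyadic_step_gt0. Qed.

Let cc_approx n t : cone_contraction C (euler_approx n t).
Proof. exact/cc_iter/ccJ. Qed.

(** One step of length [k * h] and [k] steps of length [h] share the first-order expansion
    [x + k h G x], each with error at most [k h e]. *)
Lemma euler_refine k h x e : 0 < h -> (0 < k)%N -> dom G x ->
  (forall h' j, 0 < h' -> j%:R * h' <= k%:R * h -> `|iter j (J h') (G x) - G x| <= e) ->
  `|iter k (J h) x - J (k%:R * h) x| <= 2 * (k%:R * h) * e.
Proof.
move=> h0 k0 Gx hj; set kh := k%:R * h.
have kh0 : 0 < kh by rewrite mulr_gt0// ltr0n.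
have := @euler_first_order k h x e h0 Gx; rewrite -/kh => a.
have := @euler_first_order 1 kh x e kh0 Gx; rewrite mul1r => b.
have {a}a : `|iter k (J h) x - x - kh *: G x| <= kh * e.
  apply: a => j jk; apply: hj => //.
  by rewrite /kh ler_wpM2r ?(ltW h0)// ler_nat.
have {b}b : `|J kh x - x - kh *: G x| <= kh * e.
  apply: b => j j1; apply: hj => //.
  by rewrite -[leRHS]mul1r ler_wpM2r ?(ltW kh0)// lern1.
have -> : iter k (J h) x - J kh x =
   (iter k (J h) x - x - kh *: G x) - (J kh x - x - kh *: G x) by lmodule.
have := ler_normB (iter k (J h) x - x - kh *: G x) (J kh x - x - kh *: G x).
lra.
Qed.

Lemma euler_cvgn_dom t x : 0 <= t -> dom G x -> cvgn (fun n => euler_approx n t x).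
Proof.
move=> t0 Gx; apply: cauchy_tail_cvgn => e e0.
(* Chosen so that [M * e1 + 2 * M * e1 * t = e]: the two terms bound the leftover steps and the
   accumulated refinement error. *)
pose e1 := e / (M * (1 + 2 * t)).
have den0 : 0 < M * (1 + 2 * t) by rewrite mulr_gt0// ltr_pwDl// mulr_ge0.
have e10 : 0 < e1 by exact: divr_gt0.
have [d1 d10 hd1] := euler_equicontinuous x e10.
have [d2 d20 hd2] := euler_equicontinuous (G x) e10.
have d0 : 0 < Num.min d1 d2 by rewrite lt_min d10.
have [N hN] := dyadic_step_small d0.
exists N => n Nn; rewrite /euler_approx.
have := hN N (leqnn N); rewrite le_min => /andP[Nd1 Nd2].
pose k := (2 ^ (n - N))%N.
have k0 : (0 < k)%N by rewrite expn_gt0.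
have stepE : step N = k%:R * step n := @dyadic_step_refine R _ _ Nn.
set m := dyadic_floor t N; set m' := dyadic_floor t n.
have mt : m%:R * step N <= t by exact: dyadic_floor_le.
have mkm' : (m * k <= m')%N.
  rewrite /m' /dyadic_floor truncn_ge_nat; last first.
    by rewrite divr_ge0 ?(ltW (step0 n)).
  by rewrite ler_pdivlMr// natrM -mulrA -stepE.
(* Fine steps left over after [m] coarse ones, each worth [k] fine steps; together they last at most
   [step N]. *)
pose r := (m' - m * k)%N.
have rN : r%:R * step n <= step N.
  rewrite natrB// mulrBl natrM -[X in _ - X]mulrA -stepE.
  have := dyadic_floor_le n t0; have := dyadic_floor_gt t N; rewrite -/m -/m'.
  lra.
have -> : iter m' (J (step n)) x - iter m (J (step N)) x =
    iter (m * k) (J (step n)) (iter r (J (step n)) x - x) +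
    (iter m (iter k (J (step n))) x - iter m (J (step N)) x).
  rewrite (linear_mapB (cc_linear (cc_iter _ (ccJ (step0 n))))) -iterD subnKC//.
  by rewrite iter_iter; lmodule.
have a : `|iter (m * k) (J (step n)) (iter r (J (step n)) x - x)| <= M * e1.
  rewrite (le_trans (cc_norm hX _ (cc_iter _ (ccJ (step0 n)))))//.
  by rewrite ler_wpM2l//; apply: hd1 => //; exact: le_trans rN Nd1.
have b : `|iter m (iter k (J (step n))) x - iter m (J (step N)) x| <=
    m%:R * (M * (2 * step N * e1)).
  rewrite (le_trans (norm_iter_sub hX _ _ (cc_iter _ (ccJ (step0 n))) (ccJ (step0 N)) _))//.
    move=> y; elim: k {k0 stepE mkm' r rN a} => //= k ->.
    by rewrite euler_commute.
  rewrite !ler_wpM2l// stepE; apply: euler_refine => // h' j h'0.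
  by rewrite -stepE => jh; apply: hd2 => //; exact: le_trans jh Nd2.
rewrite (le_trans (ler_normD _ _))// (le_trans (lerD a b))//.
have -> : m%:R * (M * (2 * step N * e1)) = 2 * M * e1 * (m%:R * step N) by ring.
have -> : e = M * e1 + 2 * M * e1 * t.
  have -> : M * e1 + 2 * M * e1 * t = (M * (1 + 2 * t)) * e1 by ring.
  by rewrite mulrC divfK// gt_eqF.
by rewrite lerD2l ler_wpM2l//; apply: mulr_ge0 (ltW e10); exact: mulr_ge0.
Qed.

Lemma euler_cvgn t x : 0 <= t ->
  euler_approx n t x @[n --> \oo] --> euler_semigroup t x.
Proof.
move=> t0; apply: (cc_cvgn_dense hX (euler_dense hJ) (fun n => cc_approx n t)).
by move=> {}x Gx; exact: euler_cvgn_dom.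
Qed.

Lemma cc_euler_semigroup t : 0 <= t -> cone_contraction C (euler_semigroup t).
Proof.
move=> t0; apply: (cc_limn hX (fun n => cc_approx n t)) => x.
exact: euler_cvgn.
Qed.

Lemma euler_semigroupD s t x : 0 <= s -> 0 <= t ->
  euler_semigroup (s + t) x = euler_semigroup s (euler_semigroup t x).
Proof.
move=> s0 t0; have st0 : 0 <= s + t by exact: addr_ge0.
(* The number of steps for [s + t] can exceed the sum of the two numbers by one; the extra step
   tends strongly to the identity. *)
pose r n := (dyadic_floor (s + t) n - (dyadic_floor s n + dyadic_floor t n))%N.
have floor_le n : (dyadic_floor s n + dyadic_floor t n <= dyadic_floor (s + t) n)%N.
  rewrite /dyadic_floor truncn_ge_nat ?divr_ge0 ?(ltW (step0 n))//.
  rewrite ler_pdivlMr// natrD mulrDl lerD//; exact: dyadic_floor_le.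
have r1 n : (r n <= 1)%N.
  rewrite /r leq_subLR /dyadic_floor truncn_le_nat.
  have := truncnS_gt (s / step n); have := truncnS_gt (t / step n).
  by rewrite mulrDl -!natr1 !natrD; lra.
have rx : iter (r n) (J (step n)) x @[n --> \oo] --> x.
  apply/cvgn_dist_le => e e0; have [d d0 hd] := euler_equicontinuous x e0.
  have [N hN] := dyadic_step_small d0.
  exists N => n Nn; apply: hd => //; apply: le_trans (hN n Nn).
  by rewrite -[leRHS]mul1r ler_wpM2r ?(ltW (step0 n))// lern1.
have h := cc_cvgn_apply hX (fun n => cc_approx n s) (@euler_cvgn s _ s0)
  (cc_cvgn_apply hX (fun n => cc_approx n t) (@euler_cvgn t x t0) rx).
rewrite (_ : (fun n => _) = (fun n => euler_approx n (s + t) x)) in h.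
  exact: (cvgn_unique (@euler_cvgn _ _ st0) h).
apply/funext => n; rewrite /euler_approx -!iterD ?addnA.
by rewrite subnKC.
Qed.

Lemma euler_semigroup_near0 x e : 0 < e -> exists2 d : R, 0 < d &
  forall t, 0 <= t -> t <= d -> `|euler_semigroup t x - x| <= e.
Proof.
move=> e0; have [d d0 hd] := euler_equicontinuous x e0.
exists d => // t t0 td.
have c : `|euler_approx n t x - x| @[n --> \oo] --> `|euler_semigroup t x - x|.
  by apply: cvg_norm; apply: cvgB; [exact: euler_cvgn|exact: cvg_cst].
apply: (cvgr_to_le c); near=> n; apply: hd => //.
exact: le_trans (dyadic_floor_le n t0) td.
Unshelve. all: by end_near.
Qed.

Lemma euler_semigroup_derivative x : dom G x ->
  h^-1 *: (euler_semigroup h x - x) @[h --> 0^'+] --> G x.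
Proof.
move=> Gx; apply/cvgrPdist_le => e e0; apply/near_at_right0.
have [d d0 hd] := euler_equicontinuous (G x) e0.
exists d => // t t0 td.
have -> : G x - t^-1 *: (euler_semigroup t x - x) =
    - (t^-1 *: (euler_semigroup t x - x - t *: G x)).
  by rewrite [in RHS]scalerBr [in RHS]scalerA mulVf ?gt_eqF// scale1r opprB.
have ti0 : 0 <= t^-1 by rewrite invr_ge0 ltW.
rewrite normrN (norm_scale_ge0 _ ti0) ler_pdivrMl//.
pose m n := dyadic_floor t n.
have mcvg : (m n)%:R * step n @[n --> \oo] --> t by apply: dyadic_floor_cvg; exact: ltW.
have c : `|euler_approx n t x - x - ((m n)%:R * step n) *: G x| @[n --> \oo]
    --> `|euler_semigroup t x - x - t *: G x|.
  apply: cvg_norm; apply: cvgB; last exact: cvgZl.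
  by apply: cvgB; [exact: euler_cvgn (ltW t0)|exact: cvg_cst].
have c' : (m n)%:R * step n * e @[n --> \oo] --> t * e by apply: cvgMl.
apply: (ler_cvg_to c c'); near=> n.
apply: euler_first_order => // j jm; apply: hd => //.
apply: le_trans td; apply: le_trans (dyadic_floor_le n (ltW t0)).
by rewrite ler_wpM2r ?(ltW (step0 n))// ler_nat.
Unshelve. all: by end_near.
Qed.

Lemma substochastic_euler_semigroup : substochastic C euler_semigroup.
Proof.
split; [split| |].
- by move=> t t0; exact: cc_linear (cc_euler_semigroup t0).
- by move=> t t0; exact: (cc_continuous hX (cc_euler_semigroup t0)).
- move=> x; apply: (cvgn_unique (@euler_cvgn 0 x (lexx 0))).
  rewrite (_ : (fun n => _) = fun=> x); first exact: cvg_cst.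
  by apply/funext => n; rewrite /euler_approx /dyadic_floor mul0r truncn0.
- by move=> s t x; exact: euler_semigroupD.
- move=> x; apply/cvgrPdist_le => e e0; apply/near_at_right0.
  have [d d0 hd] := euler_semigroup_near0 x e0.
  by exists d => // t t0 td; rewrite distrC hd// ltW.
- by move=> t u t0; exact: cc_pos (cc_euler_semigroup t0) u.
- by move=> t u t0; exact: cc_le (cc_euler_semigroup t0) u.
Qed.

(** If the semigroup has derivative [z] at [y], then [y] and [J 1 (y - z)] have the same image
    [y - z] under 1 minus the generator. The Laplace mean, a left inverse, identifies them, so [y]
    lies in [dom G]. *)
Lemma generates_euler_semigroup : generates G euler_semigroup.
Proof.
split; last exact: euler_semigroup_derivative.
apply/seteqP; split=> [x Gx|y /= /cvg_ex[z yz]].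
  by apply/cvg_ex; exists (G x); exact: euler_semigroup_derivative.
have left := laplace_mean_left_inverse hX substochastic_euler_semigroup ltr01.
have := left _ _ yz.
have := left _ _ (euler_semigroup_derivative (euler_dom hJ (y - z) ltr01)).
rewrite !scale1r; have := euler_right hJ (y - z) ltr01; rewrite scale1r => -> -> <-.
exact: euler_dom.
Qed.

End EulerFamilies.

(** * Exponential formula for a given semigroup *)

Section ExponentialFormula.
Context {R : realType} {X : completeNormedModType R} (C : set X)
  (hX : abstract_state_space C) (S : R -> X -> X) (H : operator X)
  (hS : substochastic C S) (hH : generates H S).
Local Notation M := (cone_bound hX).
Local Notation step := (@dyadic_step R).
Let J h := laplace_mean S h^-1.

Let hJ : euler_family C H J. Proof. exact: generator_euler_family. Qed.

Let step0 n : 0 < step n. Proof. exact: dyadic_step_gt0. Qed.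

(** Consistency and stability: [J h x] and [S h x] agree with [x + h H x] up to [h e1], and
    telescoping over at most [t / h] steps accumulates an error proportional to [t e1]. *)
Lemma euler_approx_cvg_semigroup_dom t x : 0 <= t -> dom H x ->
  euler_approx J n t x @[n --> \oo] --> S t x.
Proof.
move=> t0 Hx; have M0 := cone_bound_gt0 hX.
suff diff0 : euler_approx J n t x - S ((dyadic_floor t n)%:R * step n) x
    @[n --> \oo] --> 0.
  rewrite (_ : (fun n => euler_approx J n t x) = (fun n => euler_approx J n t x -
      S ((dyadic_floor t n)%:R * step n) x + S ((dyadic_floor t n)%:R * step n) x)).
    rewrite -[S t x]add0r; apply: cvgD diff0 _.
    exact: (semigroup_dyadic_floor_cvg hX hS).
  by apply/funext => n; rewrite subrK.
apply/cvgn_dist_le => e e0.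
(* The accumulated error is at most [2 * M * t * e1]; the summand 1 keeps the denominator positive
   at [t = 0]. *)
pose e1 := e / (M * (2 * t + 1)).
have den0 : 0 < M * (2 * t + 1) by rewrite mulr_gt0// ltr_wpDl// mulr_ge0.
have e10 : 0 < e1 by exact: divr_gt0.
have [d1 d10 hd1] := euler_equicontinuous hX hJ (H x) e10.
have [_ /(_ x Hx)/cvgrPdist_le/(_ e1 e10)/near_at_right0[d2 d20 hd2]] := hH.
have d0 : 0 < Num.min d1 d2 by rewrite lt_min d10.
have [N hN] := dyadic_step_small d0.
exists N => n Nn; rewrite subr0.
have := hN n Nn; rewrite le_min => /andP[nd1 nd2].
set h := step n in nd1 nd2 *; have h0 : 0 < h := step0 n.
set m := dyadic_floor t n.
have mt : m%:R * h <= t by exact: dyadic_floor_le.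
rewrite -(iter_semigroup hS _ _ (ltW h0)) /euler_approx -/m -/h.
have step_diff : `|J h x - S h x| <= 2 * h * e1.
  have -> : J h x - S h x = h *: ((J h (H x) - H x) + (H x - h^-1 *: (S h x - x))).
    have Jx : J h x = x + h *: J h (H x) by rewrite -(euler_step_sub hJ)// addrC subrK.
    rewrite Jx scalerDr scalerBr scalerBr scalerA divff ?gt_eqF// scale1r.
    by lmodule.
  rewrite (norm_scale_ge0 _ (ltW h0)) -mulrA mulrCA ler_pM2l// mulrDl mul1r.
  rewrite (le_trans (ler_normD _ _))// lerD//; last exact: hd2.
  by have := hd1 h 1%N h0; rewrite mul1r; apply.
rewrite (le_trans (norm_iter_sub hX _ _ (euler_cc hJ h0) (cc_semigroup hS (ltW h0)) _))//.
  by move=> y; rewrite /J (laplace_mean_commute hX hS)// ?invr_gt0// ltW.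
apply: (@le_trans _ _ (m%:R * (M * (2 * h * e1)))).
  by rewrite !ler_wpM2l// ltW.
have -> : m%:R * (M * (2 * h * e1)) = M * 2 * e1 * (m%:R * h) by ring.
apply: (@le_trans _ _ (M * 2 * e1 * t)).
  by rewrite ler_wpM2l//; apply: mulr_ge0 (ltW e10); rewrite mulr_ge0// ltW.
rewrite -[leRHS](@divfK _ (M * (2 * t + 1))) ?gt_eqF// -/e1.
rewrite -subr_ge0 (_ : _ - _ = e1 * M); last by ring.
by rewrite mulr_ge0 ?ltW.
Qed.

Lemma euler_approx_cvg_semigroup t x : 0 <= t ->
  euler_approx J n t x @[n --> \oo] --> S t x.
Proof.
move=> t0; have c := @euler_cvgn _ _ _ hX _ _ hJ t _ t0.
suff -> : S t x = euler_semigroup J t x by exact: c.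
have cE := cc_euler_semigroup hX hJ t0; have cS := cc_semigroup hS t0.
have eqD z : dom H z -> S t z = euler_semigroup J t z.
  by move=> Hz; exact: (cvgn_unique (euler_approx_cvg_semigroup_dom t0 Hz) (@c z)).
apply/eqP; rewrite -subr_eq0 -normr_le0; apply/ler_addgt0Pl => e e0.
have M0 := cone_bound_gt0 hX.
have [z Hz xz] := euler_dense hJ x (divr_gt0 e0 (addr_gt0 M0 M0)).
have -> : S t x - euler_semigroup J t x = S t (x - z) - euler_semigroup J t (x - z).
  rewrite (linear_mapB (cc_linear cS)) (linear_mapB (cc_linear cE)) (eqD z)//.
  by lmodule.
rewrite addr0 (le_trans (ler_normB _ _))//.
move: xz; rewrite ler_pdivlMr ?addr_gt0// mulrC mulrDl; apply: le_trans.
by rewrite lerD//; exact: cc_norm.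
Qed.

End ExponentialFormula.

(** * Resolvent identity and generators of pseudo-resolvents *)

Section PseudoResolvents.
Context {R : realType} {X : completeNormedModType R} (C : set X)
  (hX : abstract_state_space C).
Implicit Types (x y z : X) (h k : R) (G : operator X) (J : R -> X -> X).

Lemma iter_bounded_op_le (P Q : X -> X) n : cone_contraction C P ->
  cone_contraction C Q -> bounded_op_le C P Q ->
  bounded_op_le C (iter n P) (iter n Q).
Proof.
move=> cP cQ PQ u Cu; elim: n => [|n ih]; first by rewrite subrr; exact: cone0 hX.
rewrite !iterS (_ : _ - _ = Q (iter n Q u - iter n P u) + (Q (iter n P u) - P (iter n P u))).
  by apply: (cone_add hX); [exact: (cc_pos cQ)|exact: (PQ _ (cc_pos (cc_iter n cP) Cu))].
by rewrite (linear_mapB (cc_linear cQ)) addrA subrK.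
Qed.

(** Hilbert's resolvent identity between [1 / h] and [1 / k]. In this form, for [h <= k], the
    argument of [J h] is a convex combination of [J k x] and [x]. *)
Lemma euler_identity G J h k x : euler_family C G J -> 0 < h -> 0 < k ->
  J k x = J h ((1 - h / k) *: J k x + (h / k) *: x).
Proof.
move=> hJ h0 k0; have Gx := euler_dom hJ x k0.
rewrite -[LHS](euler_left hJ h0 Gx); congr (J h _).
have kG : k *: G (J k x) = J k x - x.
  by rewrite -[X in _ - X](euler_right hJ x k0) opprB addrC subrK.
have -> : h *: G (J k x) = (h / k) *: (k *: G (J k x)).
  by rewrite scalerA divfK// gt_eqF.
by rewrite kG; lmodule.
Qed.

Lemma resolvent_unique G lam x y : 0 < lam -> dom G y -> lam *: y - G y = x ->
  (forall y', dom G y' -> lam *: y' - G y' = x -> y' = y) -> resolvent G lam x = y.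
Proof.
move=> lam0 Gy yx uniq; rewrite /resolvent.
by case: xgetP => [z _ [Gz zx]|/(_ y)[]]; [exact: uniq|split].
Qed.

Section Resolvent.
Context (G : operator X) (J : R -> X -> X) (hJ : euler_family C G J)
  (lam : R) (lam0 : 0 < lam).

Let li0 : 0 < lam^-1. Proof. by rewrite invr_gt0. Qed.
Let lin := cc_linear (euler_cc hJ li0).

Lemma euler_resolvent_right x :
  dom G (lam^-1 *: J lam^-1 x) /\
  lam *: (lam^-1 *: J lam^-1 x) - G (lam^-1 *: J lam^-1 x) = x.
Proof.
have Gx := euler_dom hJ x li0; split; first exact: domZ.
rewrite scalerA divff ?gt_eqF// scale1r opZ//.
by rewrite (euler_right hJ).
Qed.

Lemma euler_resolvent_left y : dom G y ->
  lam^-1 *: J lam^-1 (lam *: y - G y) = y.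
Proof.
move=> Gy; rewrite -(linear_mapZ lin) scalerBr scalerA mulVf ?gt_eqF// scale1r.
by rewrite (euler_left hJ).
Qed.

Lemma resolvent_euler x : resolvent G lam x = lam^-1 *: J lam^-1 x.
Proof.
have [d e] := euler_resolvent_right x.
apply: resolvent_unique => // y' Gy' <-.
by rewrite euler_resolvent_left.
Qed.

Lemma euler_in_resolvent_set : in_resolvent_set G lam.
Proof.
split; last first.
  rewrite (_ : resolvent G lam = fun x => lam^-1 *: J lam^-1 x).
    by move=> x; apply: cvgZr; exact: (cc_continuous hX (euler_cc hJ li0)).
  by apply/funext => x; exact: resolvent_euler.
split=> //.
- move=> y y' /set_mem Gy /set_mem Gy' e.
  by rewrite -(euler_resolvent_left Gy) e euler_resolvent_left.
- move=> x _; have [d e] := euler_resolvent_right x.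
  by exists (lam^-1 *: J lam^-1 x).
Qed.

End Resolvent.

Section GeneratorOfPseudoResolvent.
Context (J : R -> X -> X) (ccJ : forall h, 0 < h -> cone_contraction C (J h))
  (Jid : forall h k x, 0 < h -> 0 < k ->
    J k x = J h ((1 - h / k) *: J k x + (h / k) *: x))
  (Jinj : forall x, J 1 x = 0 -> x = 0).

Let lin1 := cc_linear (ccJ ltr01).

(** Encodes [z = G y] for the operator [G] to be built: [(1 - G) y = y - z], inverted by [J 1]. *)
Let graph y z := J 1 (y - z) = y.

Let graph_fun y z z' : graph y z -> graph y z' -> z = z'.
Proof.
rewrite /graph => yz yz'; apply/eqP; rewrite -subr_eq0; apply/eqP/Jinj.
have -> : z - z' = (y - z') - (y - z) by lmodule.
by rewrite (linear_mapB lin1) yz yz' subrr.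
Qed.

Let graph_linear a u v zu zv : graph u zu -> graph v zv ->
  graph (a *: u + v) (a *: zu + zv).
Proof.
rewrite /graph => gu gv.
have -> : a *: u + v - (a *: zu + zv) = a *: (u - zu) + (v - zv) by lmodule.
by rewrite lin1 gu gv.
Qed.

Let D : set X := [set y | exists z, graph y z].
Let f y := xget 0 [set z | graph y z].

Let fP y : D y -> graph y (f y).
Proof. by case=> z yz; rewrite /f; case: xgetP => [//|/(_ z)]. Qed.

Let D0 : D 0.
Proof. by exists 0; rewrite /graph subrr (linear_map0 lin1). Qed.

Let Dlin a u v : D u -> D v -> D (a *: u + v).
Proof. by move=> /fP gu /fP gv; eexists; exact: graph_linear gu gv. Qed.

Let flin a u v : D u -> D v -> f (a *: u + v) = a *: f u + f v.
Proof.
move=> Du Dv; apply: (graph_fun (fP (Dlin a Du Dv))).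
by apply: graph_linear; exact: fP.
Qed.

(** The operator is read off [J 1] alone, whose injectivity makes [graph] single-valued; the
    resolvent identity between 1 and [h] then makes every [J h] an Euler step of this one
    operator. *)
Lemma pseudo_resolvent_generator : norm_dense (range (J 1)) ->
  exists2 G : operator X, euler_family C G J &
    forall y z, J 1 (y - z) = y -> dom G y /\ G y = z.
Proof.
move=> dJ; pose G := Operator D0 Dlin flin.
have GP y z : J 1 (y - z) = y -> dom G y /\ G y = z.
  move=> yz; have Dy : D y by exists z.
  by split=> //; exact: graph_fun (fP Dy) yz.
exists G => //.
have GJ h x : 0 < h -> dom G (J h x) /\ G (J h x) = h^-1 *: (J h x - x).
  move=> h0; apply: GP; rewrite [RHS](Jid _ ltr01 h0); congr (J 1 _).
  by rewrite !div1r; lmodule.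
split=> // [h x h0|h x h0|h y h0 Gy|].
- by have [] := GJ h x h0.
- by have [_ ->] := GJ h x h0; rewrite scalerA divff ?gt_eqF// scale1r; lmodule.
- have g : J 1 (y - G y) = y := fP Gy.
  rewrite -[RHS]g (Jid _ h0 ltr01) g; congr (J h _).
  by rewrite divr1; lmodule.
- move=> x e e0; have [_ [y _ <-] xy] := dJ x e e0.
  by exists (J 1 y) => //; have [] := GJ 1 y ltr01.
Qed.

End GeneratorOfPseudoResolvent.
End PseudoResolvents.

(** * Neumann series for the perturbed operator [A + B] *)

Section KatoPerturbation.
Context {R : realType} {X : completeNormedModType R} (C : set X)
  (hX : abstract_state_space C) (Psi : {scalar X}) (hPsi : norm_functional C Psi)
  (A B : operator X) (J : R -> X -> X) (hJ : euler_family C A J)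
  (hBdom : dom B = dom A) (hBpos : positive_op C B)
  (hAB : forall u, dom A u -> C u -> Psi (A u + B u) <= 0).
Implicit Types (x y z u v : X) (h k : R).
Local Notation M := (cone_bound hX).

Let ccJ h : 0 < h -> cone_contraction C (J h). Proof. exact: euler_cc hJ _. Qed.
Let linJ h (h0 : 0 < h) := cc_linear (ccJ h0).
Let domJ h x : 0 < h -> dom A (J h x). Proof. exact: euler_dom hJ _ _. Qed.
Let domBJ h x : 0 < h -> dom B (J h x). Proof. by rewrite hBdom; exact: domJ. Qed.
Let M0 : 0 < M. Proof. exact: cone_bound_gt0. Qed.

(* [K h = B (lam - A)^-1] for [lam = 1 / h]. *)
Let K h x := h *: B (J h x).

Let K_linear h : 0 < h -> linear (K h).
Proof. by move=> h0 a x y; rewrite /K linJ// op_linear; [lmodule|exact: domBJ..]. Qed.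

Let K_pos h u : 0 < h -> C u -> C (K h u).
Proof.
move=> h0 Cu; apply: (cone_scale hX (ltW h0)); apply: hBpos; first exact: domBJ.
exact: (cc_pos (ccJ h0)).
Qed.

(* Dissipativity [Psi ((A + B) v) <= 0] at [v = J h u]. *)
Lemma norm_kato_step h u : 0 < h -> C u -> `|J h u| + `|K h u| <= `|u|.
Proof.
move=> h0 Cu; have [_ PsiC] := hPsi.
have CJ : C (J h u) := cc_pos (ccJ h0) Cu.
rewrite -!PsiC//; last exact: K_pos.
have uE : u = J h u - h *: A (J h u) by rewrite (euler_right hJ).
rewrite [leRHS](_ : _ = Psi (J h u) + Psi (K h u) - h * Psi (A (J h u) + B (J h u))).
  by rewrite lerDl oppr_ge0 pmulr_rle0//; apply: hAB => //; exact: domJ.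
have -> : Psi (K h u) = h * Psi (B (J h u)) by exact: linearZ.
have -> : Psi (A (J h u) + B (J h u)) = Psi (A (J h u)) + Psi (B (J h u)).
  exact: linearD.
have -> : Psi u = Psi (J h u) - h * Psi (A (J h u)).
  by rewrite [in LHS]uE linearB linearZ.
by ring.
Qed.

Let cc_K h : 0 < h -> cone_contraction C (K h).
Proof.
move=> h0; split; [exact: K_linear|by move=> u; exact: K_pos|move=> u Cu].
by apply: le_trans (norm_kato_step h0 Cu); rewrite lerDr.
Qed.

Let Ksum h n x := \sum_(0 <= k < n.+1) iter k (K h) x.

Let Ksum_linear h n : 0 < h -> linear (Ksum h n).
Proof.
move=> h0 a x y; rewrite /Ksum scaler_sumr -big_split/=; apply: eq_bigr => k _.
by rewrite (cc_linear (cc_iter k (cc_K h0))).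
Qed.

Let Ksum_pos h n u : 0 < h -> C u -> C (Ksum h n u).
Proof.
move=> h0 Cu; apply: big_ind => [|x y|k _]; [exact: cone0 hX|exact: cone_add|].
exact: (cc_pos (cc_iter k (cc_K h0))).
Qed.

Let KsumS h n x : Ksum h n.+1 x = Ksum h n x + iter n.+1 (K h) x.
Proof. by rewrite /Ksum big_nat_recr. Qed.

Let Ksum_sub h n x : 0 < h -> Ksum h n x - K h (Ksum h n x) = x - iter n.+1 (K h) x.
Proof.
move=> h0; elim: n => [|n ih]; first by rewrite /Ksum big_nat1.
rewrite KsumS (linear_mapD (K_linear h0)).
rewrite (_ : _ - _ = (Ksum h n x - K h (Ksum h n x)) +
  (iter n.+1 (K h) x - iter n.+2 (K h) x)); last by rewrite /=; lmodule.
by rewrite ih; lmodule.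
Qed.

(* [lam (lam - A)^-1 \sum_(k <= n) (B (lam - A)^-1) ^ k] at [lam = 1 / h] *)
Definition kato_sum h n x : X := J h (Ksum h n x).

Definition kato_limit h x : X := limn (fun n => kato_sum h n x).

Lemma cc_kato_sum h n : 0 < h -> cone_contraction C (kato_sum h n).
Proof.
move=> h0; split=> [a x y|u Cu|u Cu].
- by rewrite /kato_sum Ksum_linear// linJ.
- by apply: (cc_pos (ccJ h0)); exact: Ksum_pos.
(* Carrying the norm of the remainder along makes the induction work: [norm_kato_step], applied to
   the remainder, pays for both the next term of the sum and the next remainder. *)
suff : `|kato_sum h n u| + `|iter n.+1 (K h) u| <= `|u|.
  by apply: le_trans; rewrite lerDl.
elim: n => [|n ih].
  by rewrite /kato_sum /Ksum big_nat1 /=; exact: norm_kato_step.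
rewrite /kato_sum KsumS (linear_mapD (linJ h0)).
apply: le_trans ih; rewrite (le_trans (lerD (ler_normD _ _) (lexx _)))//.
rewrite -addrA lerD2l iterS; apply: norm_kato_step => //.
exact: (cc_pos (cc_iter n.+1 (cc_K h0))).
Qed.

Lemma kato_sum_cvgn h x : 0 < h -> kato_sum h n x @[n --> \oo] --> kato_limit h x.
Proof.
move=> h0; suff Ccvg u : C u -> cvgn (fun n => kato_sum h n u).
  have [u [v [Cu Cv ->]]] := cone_generating hX x.
  rewrite /kato_limit (_ : (fun n => _) = (fun n => kato_sum h n u - kato_sum h n v)).
    exact: is_cvgB (Ccvg u Cu) (Ccvg v Cv).
  by apply/funext => n; rewrite (linear_mapB (cc_linear (cc_kato_sum n h0))).
move=> Cu; apply: (cone_incr_cvgn hX (b := `|u|)) => [|n|n].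
- exact: (cc_pos (cc_kato_sum 0 h0)).
- rewrite /kato_sum KsumS (linear_mapD (linJ h0)) addrAC subrr add0r.
  by apply: (cc_pos (ccJ h0)); exact: (cc_pos (cc_iter n.+1 (cc_K h0))).
- exact: (cc_le (cc_kato_sum n h0)).
Qed.

Lemma cc_kato_limit h : 0 < h -> cone_contraction C (kato_limit h).
Proof.
move=> h0; apply: (cc_limn hX (fun n => cc_kato_sum n h0)) => x.
exact: kato_sum_cvgn.
Qed.

Let linL h (h0 : 0 < h) := cc_linear (cc_kato_limit h0).

(** These are increments of the convergent Neumann sums; nothing is claimed about
    [iter n.+1 (K h) x] itself. *)
Let J_iterK_cvg0 h x : 0 < h -> J h (iter n.+1 (K h) x) @[n --> \oo] --> 0.
Proof.
move=> h0; have c := @kato_sum_cvgn h x h0.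
have cS : kato_sum h n.+1 x @[n --> \oo] --> kato_limit h x.
  by have := c; rewrite -cvg_shiftS.
rewrite -(subrr (kato_limit h x)).
rewrite (_ : (fun n => _) = (fun n => kato_sum h n.+1 x - kato_sum h n x)).
  exact: cvgB cS c.
apply/funext => n; rewrite /kato_sum KsumS (linear_mapD (linJ h0)).
by rewrite addrAC subrr add0r.
Qed.

Lemma kato_sum_dom h n x : 0 < h -> dom A (kato_sum h n x).
Proof. exact: domJ. Qed.

Lemma kato_sum_right h n x : 0 < h ->
  kato_sum h n x - h *: (A (kato_sum h n x) + B (kato_sum h n x)) =
  x - iter n.+1 (K h) x.
Proof.
move=> h0; rewrite -Ksum_sub// scalerDr opprD addrA.
by rewrite [X in X - _](euler_right hJ).
Qed.

(** With [v = J h w], the sums for [w - K h w] telescope to [v] minus [J h] of the remainder of [w],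
    so the remainders have to vanish only after [J h]. *)
Lemma kato_limit_left h v : 0 < h -> dom A v ->
  kato_limit h (v - h *: (A v + B v)) = v.
Proof.
move=> h0 Av; set w := v - h *: A v.
have vE : J h w = v by exact: (euler_left hJ).
have -> : v - h *: (A v + B v) = w - K h w by rewrite /K vE /w; lmodule.
have cS : v - J h (iter n.+1 (K h) w) @[n --> \oo] --> v - 0.
  by apply: cvgB; [exact: cvg_cst|exact: J_iterK_cvg0].
rewrite subr0 in cS; apply: (cvgn_unique (@kato_sum_cvgn _ _ h0)).
rewrite (_ : (fun n => _) = (fun n => v - J h (iter n.+1 (K h) w)))//.
apply/funext => n; rewrite -[in RHS]vE -(linear_mapB (linJ h0)); congr (J h _).
rewrite -Ksum_sub// (linear_mapB (Ksum_linear n h0)); congr (_ - _).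
rewrite /Ksum (linear_map_sum (K_linear h0)); apply: eq_bigr => k _.
by rewrite -iterSr.
Qed.

(** * Resolvent identity for the Neumann limits *)

Section ResolventIdentity.
Context (h k : R) (h0 : 0 < h) (k0 : 0 < k).
Let c := h / k.
Let c0 : 0 < c. Proof. exact: divr_gt0. Qed.

(** The partial sums lie in [dom A], where [kato_limit h] inverts [1 - h (A + B)]. They satisfy the
    identity up to [c] times [kato_limit h] of the remainder of the series at step [k], the term
    assumed to vanish. *)
Lemma kato_identity_of_vanishing x :
  kato_limit h (iter n.+1 (K k) x) @[n --> \oo] --> 0 ->
  kato_limit k x = kato_limit h ((1 - c) *: kato_limit k x + c *: x).
Proof.
move=> van; have cv := @kato_sum_cvgn k x k0.
pose y n := kato_sum k n x.
have yE n : y n = kato_limit h ((1 - c) *: y n + c *: x) -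
    c *: kato_limit h (iter n.+1 (K k) x).
  rewrite -(linear_mapZ (linL h0)) -(linear_mapB (linL h0)).
  rewrite -[LHS](kato_limit_left h0 (kato_sum_dom n x k0)); congr (kato_limit h _).
  rewrite -addrA -scalerBr -(kato_sum_right n x k0) -/(y n).
  have -> : h *: (A (y n) + B (y n)) = c *: (k *: (A (y n) + B (y n))).
    by rewrite scalerA divfK// gt_eqF.
  by lmodule.
have lim : kato_limit h ((1 - c) *: y n + c *: x) - c *: kato_limit h (iter n.+1 (K k) x)
    @[n --> \oo] --> kato_limit h ((1 - c) *: kato_limit k x + c *: x) - c *: 0.
  apply: cvgB; last exact: cvgZr.
  apply: (cc_cvgn_apply hX (fun=> cc_kato_limit h0) (cvg_cst _)).
  by apply: cvgD; [exact: cvgZr|exact: cvg_cst].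
rewrite scaler0 subr0 in lim; apply: (cvgn_unique cv).
by rewrite (_ : (fun n => _) = (fun n => kato_limit h ((1 - c) *: y n + c *: x) -
  c *: kato_limit h (iter n.+1 (K k) x)))//; apply/funext.
Qed.

(** The resolvent identity gives [c J h <= J k] on the cone, hence [K h <= K k] as [B] is positive;
    the Neumann sums are then compared term by term. *)
Lemma kato_limit_comparison u : h <= k -> C u ->
  C (kato_limit k u - c *: kato_limit h u).
Proof.
move=> hk; have c1 : c <= 1 by rewrite ler_pdivrMr// mul1r.
have JJ v : C v -> C (J k v - c *: J h v).
  move=> Cv; rewrite (euler_identity v hJ h0 k0) (linear_mapD (linJ h0)).
  rewrite !(linear_mapZ (linJ h0)) -/c addrK; apply: (cone_scale hX).
    by rewrite subr_ge0.
  by apply: (cc_pos (ccJ h0)); exact: (cc_pos (ccJ k0)).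
have KK : bounded_op_le C (K h) (K k).
  move=> v Cv; rewrite (_ : _ - _ = k *: B (J k v - c *: J h v)).
    apply: (cone_scale hX (ltW k0)); apply: hBpos; last exact: JJ.
    by apply: domB; [exact: domBJ|apply: domZ; exact: domBJ].
  rewrite opB; [|exact: domBJ|by apply: domZ; exact: domBJ].
  rewrite opZ; last exact: domBJ.
  by rewrite scalerBr scalerA mulrC divfK// gt_eqF.
move=> Cu; apply: (cone_limn hX (w := fun n => kato_sum k n u - c *: kato_sum h n u)).
  move=> n; rewrite (_ : _ - _ = J k (Ksum k n u - Ksum h n u) +
      (J k (Ksum h n u) - c *: J h (Ksum h n u))).
    apply: (cone_add hX); last by apply: JJ; exact: Ksum_pos.
    apply: (cc_pos (ccJ k0)); rewrite /Ksum -sumrB.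
    apply: big_ind => [|x y|j _]; [exact: cone0 hX|exact: cone_add|].
    exact: (iter_bounded_op_le hX j (cc_K h0) (cc_K k0) KK).
  by rewrite (linear_mapB (linJ k0)) addrA subrK.
by apply: cvgB; [exact: kato_sum_cvgn|apply: cvgZr; exact: kato_sum_cvgn].
Qed.

(* From [c J_h <= J_k] on the cone when [h <= k]. *)
Lemma kato_vanish_le u : h <= k -> C u ->
  kato_limit k (iter n.+1 (K k) u) @[n --> \oo] --> 0 ->
  kato_limit h (iter n.+1 (K k) u) @[n --> \oo] --> 0.
Proof.
move=> hk Cu van; apply/cvgn_dist_le => e e0.
have /cvgn_dist_le/(_ (c * e) (mulr_gt0 c0 e0))[N hN] := van.
exists N => n /hN; rewrite !subr0 => le.
have Cw : C (iter n.+1 (K k) u) := cc_pos (cc_iter n.+1 (cc_K k0)) Cu.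
have Cl : C (c *: kato_limit h (iter n.+1 (K k) u)).
  by apply: (cone_scale hX (ltW c0)); exact: (cc_pos (cc_kato_limit h0)).
rewrite -(ler_pM2l c0) -(norm_scale_ge0 _ (ltW c0)); apply: le_trans le.
exact: (norm_cone_mono hX Cl (kato_limit_comparison hk Cw)).
Qed.

End ResolventIdentity.

(** By [kato_limit_left] at the partial sum, combined with [kato_sum_right], this vector is the
    error [kato_limit k x - kato_sum k n x]. *)
Let kato_vanish_diag k x : 0 < k ->
  kato_limit k (iter n.+1 (K k) x) @[n --> \oo] --> 0.
Proof.
move=> k0.
rewrite -(subrr (kato_limit k x)).
rewrite (_ : (fun n => _) = (fun n => kato_limit k x - kato_sum k n x)).
  by apply: cvgB; [exact: cvg_cst|exact: kato_sum_cvgn].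
apply/funext => n.
rewrite -[in RHS](kato_limit_left k0 (kato_sum_dom n x k0)).
by rewrite kato_sum_right// (linear_mapB (linL k0)); lmodule.
Qed.

Let kato_identity_le h k u : 0 < h -> 0 < k -> h <= k -> C u ->
  kato_limit k u = kato_limit h ((1 - h / k) *: kato_limit k u + (h / k) *: u).
Proof.
move=> h0 k0 hk Cu; apply: kato_identity_of_vanishing => //.
by apply: kato_vanish_le => //; exact: kato_vanish_diag.
Qed.

(* With [z = J_h w], the identity with [h] and [k] exchanged reads
   [z = J_k ((1 - k / h) z + (k / h) w)], so that [|z| <= |J_k w|]. *)
Let kato_vanish_ge h k u : 0 < h -> 0 < k -> k <= h -> C u ->
  kato_limit h (iter n.+1 (K k) u) @[n --> \oo] --> 0.
Proof.
move=> h0 k0 kh Cu; apply/cvgn_dist_le => e e0.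
have /cvgn_dist_le/(_ e e0)[N hN] := @kato_vanish_diag k u k0.
exists N => n /hN; rewrite !subr0; apply: le_trans.
set w := iter n.+1 (K k) u.
have Cw : C w := cc_pos (cc_iter n.+1 (cc_K k0)) Cu.
have := kato_identity_le k0 h0 kh Cw.
set z := kato_limit h w; set b := k / h => zE.
have Cz : C z := cc_pos (cc_kato_limit h0) Cw.
have b0 : 0 < b by exact: divr_gt0.
have b1 : 0 <= 1 - b by rewrite subr_ge0 ler_pdivrMr// mul1r.
have : `|z| <= (1 - b) * `|z| + b * `|kato_limit k w|.
  rewrite {1}zE (linear_mapD (linL k0)) !(linear_mapZ (linL k0)).
  rewrite (le_trans (ler_normD _ _))//.
  rewrite (norm_scale_ge0 _ b1) (norm_scale_ge0 _ (ltW b0)) lerD2r.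
  by rewrite ler_wpM2l//; exact: (cc_le (cc_kato_limit k0)).
by move=> zle; rewrite -(ler_pM2l b0); lra.
Qed.

Lemma kato_identity h k x : 0 < h -> 0 < k ->
  kato_limit k x = kato_limit h ((1 - h / k) *: kato_limit k x + (h / k) *: x).
Proof.
move=> h0 k0.
have idC u : C u ->
    kato_limit k u = kato_limit h ((1 - h / k) *: kato_limit k u + (h / k) *: u).
  move=> Cu; have [hk|kh] := leP h k; first exact: kato_identity_le.
  apply: kato_identity_of_vanishing => //.
  by apply: kato_vanish_ge => //; exact: ltW.
have [u [v [Cu Cv ->]]] := cone_generating hX x.
rewrite (linear_mapB (linL k0)) [in LHS](idC u Cu) [in LHS](idC v Cv).
rewrite -(linear_mapB (linL h0)); congr (kato_limit h _).
by lmodule.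
Qed.

(** By the resolvent identity a zero of [kato_limit 1] is a zero of every [kato_limit h], and these
    maps tend strongly to the identity as [h -> 0], by [kato_limit_left] on the dense domain of
    [A]. *)
Lemma kato_limit_inj x : kato_limit 1 x = 0 -> x = 0.
Proof.
move=> x0; have Lx h : 0 < h -> kato_limit h x = 0.
  move=> h0; have := kato_identity x h0 ltr01.
  rewrite x0 divr1 scaler0 add0r (linear_mapZ (linL h0)) => /esym/eqP.
  by rewrite scaler_eq0 gt_eqF//= => /eqP.
apply/eqP; rewrite -normr_le0; apply/ler_addgt0Pl => e e0; rewrite addr0.
have d0 : 0 < e / 2 / (M + 1) by rewrite !divr_gt0 ?addr_gt0.
have [v Av xv] := euler_dense hJ x d0.
pose g := A v + B v.
have c0 : 0 < M * `|g| + 1 by rewrite ltr_wpDl// mulr_ge0// ltW.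
(* Makes [h] times the norm of [kato_limit h g] at most [e / 2]; the other half pays for replacing
   [x] by [v]. *)
pose h := e / 2 / (M * `|g| + 1).
have h0 : 0 < h by rewrite !divr_gt0.
have vE : kato_limit h v = v + h *: kato_limit h g.
  have e' := kato_limit_left h0 Av.
  rewrite (linear_mapB (linL h0)) (linear_mapZ (linL h0)) -/g in e'.
  by apply/eqP; rewrite -subr_eq e'.
have -> : x = (x - v) + kato_limit h (v - x) - h *: kato_limit h g.
  by rewrite (linear_mapB (linL h0)) Lx// subr0 vE; lmodule.
rewrite (le_trans (ler_normB _ _))// (norm_scale_ge0 _ (ltW h0)).
have := ler_normD (x - v) (kato_limit h (v - x)).
have : `|kato_limit h (v - x)| <= M * `|x - v|.
  by rewrite (distrC x); exact: cc_norm (cc_kato_limit h0).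
have : (M + 1) * `|x - v| <= e / 2 by rewrite mulrC -ler_pdivlMr ?addr_gt0.
suff : h * `|kato_limit h g| <= e / 2 by lra.
have -> : e / 2 = h * (M * `|g| + 1) by rewrite /h divfK// gt_eqF.
rewrite (ler_pM2l h0) (le_trans (cc_norm hX _ (cc_kato_limit h0)))//.
by rewrite lerDl.
Qed.

(** The range of [kato_limit 1] contains [dom A] by [kato_limit_left]; this yields both its density
    and the extension property. *)
Lemma kato_generator : exists2 G : operator X, euler_family C G kato_limit &
  extends G (add_op A B).
Proof.
have left1 v : dom A v -> kato_limit 1 (v - (A v + B v)) = v.
  by move=> Av; have := kato_limit_left ltr01 Av; rewrite scale1r.
have [|G hG GP] := pseudo_resolvent_generator cc_kato_limit kato_identity kato_limit_inj.
  move=> x e e0; have [v Av xv] := euler_dense hJ x e0.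
  by exists v => //; eexists; [|exact: left1].
exists G => //; split=> [v [Av _]|v [Av _]].
- by have [] := GP v _ (left1 v Av).
- by have [_ ->] := GP v _ (left1 v Av).
Qed.

(** A partial sum [y] lies in [dom H], and [u - (y - h H y)] is the remainder of the series. Hence
    [JH h u - y] is [JH h] of a positive vector. *)
Lemma kato_limit_le H (JH : R -> X -> X) h : euler_family C H JH ->
  extends H (add_op A B) -> 0 < h -> bounded_op_le C (kato_limit h) (JH h).
Proof.
move=> hJH [domH HE] h0 u Cu.
have linH := cc_linear (euler_cc hJH h0).
apply: (cone_limn hX (w := fun n => JH h u - kato_sum h n u)).
  move=> n; have Dy : dom (add_op A B) (kato_sum h n u).
    by split; [|rewrite hBdom]; exact: kato_sum_dom.
  rewrite -{1}(euler_left hJH h0 (domH _ Dy)) (HE _ Dy) /= kato_sum_right//.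
  rewrite (linear_mapB linH) opprB addrC subrK.
  by apply: (cc_pos (euler_cc hJH h0)); exact: (cc_pos (cc_iter n.+1 (cc_K h0))).
by apply: cvgB; [exact: cvg_cst|exact: kato_sum_cvgn].
Qed.

Lemma kato_minimal (S : R -> X -> X) (H : operator X) : substochastic C S ->
  generates H S -> extends H (add_op A B) -> forall t, 0 <= t ->
  forall G, euler_family C G kato_limit ->
  bounded_op_le C (euler_semigroup kato_limit t) (S t).
Proof.
move=> hS hH HAB t t0 G hG u Cu.
have hJH := generator_euler_family hX hS hH.
have cV := @euler_cvgn _ _ _ hX _ _ hG t u t0.
have cS := @euler_approx_cvg_semigroup _ _ _ hX _ _ hS hH t u t0.
apply: (cone_limn hX _ (cvgB cS cV)) => n.
have h0 := @dyadic_step_gt0 R n.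
apply: (iter_bounded_op_le hX _ (euler_cc hG h0) (euler_cc hJH h0)) => //.
exact: kato_limit_le hJH HAB h0.
Qed.

Lemma resolvent_kato_sum lam n u : 0 < lam ->
  resolvent A lam (\sum_(0 <= k < n.+1)
    iter k (fun x => B (resolvent A lam x)) u) = lam^-1 *: kato_sum lam^-1 n u.
Proof.
move=> lam0; rewrite (resolvent_euler hJ lam0) /kato_sum /Ksum.
congr (_ *: J _ _); apply: eq_bigr => k _; congr (iter k _ u).
apply/funext => x; rewrite (resolvent_euler hJ lam0) opZ//.
by apply: domBJ; rewrite invr_gt0.
Qed.

End KatoPerturbation.

Unset Implicit Arguments.
Set Strict Implicit.
Set Printing Implicit Defensive.

Theorem theorem2p1 (R : realType) (X : completeNormedModType R) (C : set X)
    (Psi : {scalar X}) (U : R -> X -> X) (A B : operator X)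
    (hX : abstract_state_space C) (hPsi : norm_functional C Psi)
    (hU : substochastic C U) (hA : generates A U)
    (hBdom : dom B = dom A) (hBpos : positive_op C B)
    (hAB : forall u, dom A u -> C u -> Psi (A u + B u) <= 0) :
  exists (G : operator X) (V : R -> X -> X),
    [/\ extends G (add_op A B),
        substochastic C V /\ generates G V,
        forall lambda : R, 0 < lambda ->
          in_resolvent_set G lambda /\
          forall u : X,
            resolvent A lambda
              (\sum_(0 <= k < n.+1) iter k (fun x => B (resolvent A lambda x)) u)
              @[n --> \oo] --> resolvent G lambda u &
        forall (S : R -> X -> X) (H : operator X),
          substochastic C S -> generates H S -> extends H (add_op A B) ->
          forall t, 0 <= t -> bounded_op_le C (V t) (S t)].
Proof.
have hJ := generator_euler_family hX hU hA.
have [G hG GAB] := kato_generator hX hPsi hJ hBdom hBpos hAB.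
exists G, (euler_semigroup (kato_limit B (fun h => laplace_mean U h^-1))); split=> //.
- split; first exact: (substochastic_euler_semigroup hX hG).
  exact: (generates_euler_semigroup hX hG).
- move=> lam lam0; split; first exact: (euler_in_resolvent_set hX hG).
  move=> u; rewrite (resolvent_euler hG lam0).
  rewrite (_ : (fun n => _) = (fun n => lam^-1 *:
      kato_sum B (fun h => laplace_mean U h^-1) lam^-1 n u)).
    apply: cvgZr; apply: (kato_sum_cvgn hX hPsi hJ hBdom hBpos hAB).
    by rewrite invr_gt0.
  by apply/funext => n; rewrite (resolvent_kato_sum hJ hBdom).
- move=> S H hS hH HAB t t0.
  exact: (kato_minimal hX hPsi hJ hBdom hBpos hAB hS hH HAB t0 hG).
Qed.
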